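(* Let $\mathcal{S}=(A,B,C,M_1,\ldots,M_p)$ and $\mathcal{S}_r=(A_r,B_r,C_r,M_{1,r},\ldots,M_{p,r})$ be asymptotically stable linear quadratic-output systems of state dimensions $n$ and $r$, respectively, with the same number $m$ of inputs and $p$ of outputs. Let $\mathcal{S}_r$ be a local minimizer of the squared $\mathcal{H}_2$ error $\mathcal{J}(\mathcal{S}_r)=\|\mathcal{S}-\mathcal{S}_r\|_{\mathcal{H}_2}^2$. Let $X,Z,Z_1\in\mathbb{R}^{n\times r}$ and $P_r,Q_r,Q_{1,r}\in\mathbb{R}^{r\times r}$ be the unique solutions of $$A_rP_r+P_rA_r^{\mathsf T}+B_rB_r^{\mathsf T}=0,$$ $$A_r^{\mathsf T}Q_r+Q_rA_r+\sum_{k=1}^pM_{k,r}P_rM_{k,r}+C_r^{\mathsf T}C_r=0,$$ $$AX+XA_r^{\mathsf T}+BB_r^{\mathsf T}=0,$$ $$A^{\mathsf T}Z+ZA_r-\sum_{k=1}^pM_kXM_{k,r}-C^{\mathsf T}C_r=0,$$ $$A_r^{\mathsf T}Q_{1,r}+Q_{1,r}A_r+C_r^{\mathsf T}C_r=0,$$ $$A^{\mathsf T}Z_1+Z_1A_r-C^{\mathsf T}C_r=0.$$ Then $\mathcal{S}_r$ satisfies the first-order optimality conditions $$0=(2Q_r-Q_{1,r})P_r+(2Z^{\mathsf T}-Z_1^{\mathsf T})X,$$ $$0=(2Q_r-Q_{1,r})B_r+(2Z^{\mathsf T}-Z_1^{\mathsf T})B,$$ $$0=C_rP_r-CX,$$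 $$0=P_rM_{k,r}P_r-X^{\mathsf T}M_kX,\qquad k=1,\ldots,p.$$ Further, if $P_r$ and $2Q_r-Q_{1,r}$ are nonsingular, then the $\mathcal{H}_2$-optimal reduced model $\mathcal{S}_r$ is obtained by Petrov--Galerkin projection, that is, $$A_r=(W_r^{\mathsf T}V_r)^{-1}W_r^{\mathsf T}AV_r,\quad B_r=(W_r^{\mathsf T}V_r)^{-1}W_r^{\mathsf T}B,\quad C_r=CV_r,\quad M_{k,r}=V_r^{\mathsf T}M_kV_r\ \ (k=1,\ldots,p),$$ where $V_r,W_r\in\mathbb{R}^{n\times r}$ are given by $$V_r=XP_r^{-1},\qquad W_r=-(2Z-Z_1)(2Q_r-Q_{1,r})^{-1},$$ and satisfy $W_r^{\mathsf T}V_r=I_r$.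
   Context: A linear quadratic-output (LQO) system $\mathcal{S}=(A,B,C,M_1,\ldots,M_p)$ of state dimension $n$ with $m$ inputs and $p$ outputs is given by $A,M_1,\ldots,M_p\in\mathbb{R}^{n\times n}$, $B\in\mathbb{R}^{n\times m}$, $C\in\mathbb{R}^{p\times n}$ via $$\dot x(t)=Ax(t)+Bu(t),\quad x(0)=0,\qquad y(t)=Cx(t)+\begin{bmatrix}x(t)^{\mathsf T}M_1x(t)\\ \vdots\\ x(t)^{\mathsf T}M_px(t)\end{bmatrix}.$$ Throughout, the quadratic-output matrices $M_k$ of every LQO system (full or reduced) are symmetric. The system is asymptotically stable if all eigenvalues of $A$ lie in the open left half of the complex plane. A system $\mathcal{S}_r=(A_r,B_r,C_r,M_{1,r},\ldots,M_{p,r})$ is an LQO system of the same form with state dimension $r$, i.e. $A_r,M_{k,r}\in\mathbb{R}^{r\times r}$, $B_r\in\mathbb{R}^{r\times m}$, $C_r\in\mathbb{R}^{p\times r}$. Volterra kernels: let $M\in\mathbb{R}^{p\times n^2}$ be the matrix whose $k$-th row is $\operatorname{vec}(M_k)^{\mathsf T}$. The kernels of $\mathcal{S}$ are $$h_1(t)=Ce^{At}B\in\mathbb{R}^{p\times m},\qquad h_2(t_1,t_2)=M\left(e^{At_1}B\otimes e^{At_2}B\right)\in\mathbb{R}^{p\times m^2},\qquad t,t_1,t_2\ge0,$$ and $h_{1,r},h_{2,r}$ are defined analogously for $\mathcal{S}_r$. The squared $\mathcal{H}_2$ error is $$\|\mathcal{S}-\mathcal{S}_r\|_{\mathcal{H}_2}^2=\int_0^\infty\|h_1(\tau)-h_{1,r}(\tau)\|_F^2\,d\tau+\int_0^\infty\int_0^\infty\|h_2(\tau_1,\tau_2)-h_{2,r}(\tau_1,\tau_2)\|_F^2\,d\tau_1\,d\tau_2,$$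 where $\|\cdot\|_F$ is the Frobenius norm. The system $\mathcal{S}$ is fixed, and $\mathcal{J}$ is regarded as a real-valued function of the matrices $(A_r,B_r,C_r,M_{1,r},\ldots,M_{p,r})$ in $\mathbb{R}^{r\times r}\times\mathbb{R}^{r\times m}\times\mathbb{R}^{p\times r}\times\mathbb{R}^{r\times r}\times\cdots\times\mathbb{R}^{r\times r}$, on the open set where $A_r$ has all its eigenvalues in the open left half-plane (asymptotically stable LQO systems of order $r$). ''Local minimizer'' means local minimizer of $\mathcal{J}$ as a function of these matrices. *)

(* Defs.v *)
From HB Require Import structures.
From mathcomp Require Import all_boot all_order all_algebra.
From mathcomp Require Import all_classical all_reals all_analysis.
From mathcomp Require Import complex mxtens.

Set Implicit Arguments.
Unset Strict Implicit.
Unset Printing Implicit Defensive.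

Import Order.TTheory GRing.Theory Num.Theory.
Import numFieldNormedType.Exports.

Local Open Scope classical_set_scope.
Local Open Scope ring_scope.

(* (A, B, C, M) with state dimension n, m inputs and p outputs; M k is the
   k-th quadratic-output matrix. The type carries the topology of the finite
   product R^(n x n) x R^(n x m) x R^(p x n) x (R^(n x n))^p. Symmetry of the
   M k is not part of the type: it is a separate predicate. *)
Definition lqo (R : realType) (n m p : nat) : Type :=
  ('M[R]_n * 'M[R]_(n, m) * 'M[R]_(p, n) * {ptws 'I_p -> 'M[R]_n})%type.

HB.instance Definition _ (R : realType) (n m p : nat) :=
  Topological.copy (lqo R n m p)
    ('M[R]_n * 'M[R]_(n, m) * 'M[R]_(p, n) * {ptws 'I_p -> 'M[R]_n})%type.

Section LQO.
Context {R : realType}.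

Definition lqoA {n m p : nat} (S : lqo R n m p) : 'M[R]_n := S.1.1.1.
Definition lqoB {n m p : nat} (S : lqo R n m p) : 'M[R]_(n, m) := S.1.1.2.
Definition lqoC {n m p : nat} (S : lqo R n m p) : 'M[R]_(p, n) := S.1.2.
Definition lqoM {n m p : nat} (S : lqo R n m p) : 'I_p -> 'M[R]_n := S.2.

Definition lqo_symmetric {n m p : nat} (S : lqo R n m p) : Prop :=
  forall k, (lqoM S k)^T = lqoM S k.

Definition hurwitz {n : nat} (A : 'M[R]_n) : Prop :=
  forall z : R[i],
    eigenvalue (map_mx (real_complex R) A) z -> complex.Re z < 0.

Definition asymptotically_stable {n m p : nat} (S : lqo R n m p) : Prop :=
  hurwitz (lqoA S).

Definition expmx {n : nat} (A : 'M[R]_n) : 'M[R]_n :=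
  limn (series (fun k => (k`!%:R)^-1 *: A ^+ k)).

Definition frobenius_norm {a b : nat} (A : 'M[R]_(a, b)) : R :=
  Num.sqrt (\sum_i \sum_j A i j ^+ 2).

(* mxvec stacks rows; the usual vec stacks columns, hence the transpose. *)
Definition vec {a b : nat} (A : 'M[R]_(a, b)) : 'cV[R]_(b * a) :=
  (mxvec A^T)^T.

Definition quad_mx {n m p : nat} (S : lqo R n m p) : 'M[R]_(p, n * n) :=
  \matrix_k (vec (lqoM S k))^T.

Definition kernel1 {n m p : nat} (S : lqo R n m p) (t : R) : 'M[R]_(p, m) :=
  lqoC S *m expmx (t *: lqoA S) *m lqoB S.

Definition kernel2 {n m p : nat} (S : lqo R n m p) (t1 t2 : R) :
    'M[R]_(p, m * m) :=
  quad_mx S *m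
    ((expmx (t1 *: lqoA S) *m lqoB S) *t (expmx (t2 *: lqoA S) *m lqoB S)).

(* Valued in the extended reals, where integrals of nonnegative functions
   always make sense; it is finite when both systems are asymptotically
   stable. *)
Definition h2_error_sq {n r m p : nat} (S : lqo R n m p) (Sr : lqo R r m p) :
    \bar R :=
  (\int[lebesgue_measure]_(t in `[0%R, +oo[)
      (frobenius_norm (kernel1 S t - kernel1 Sr t) ^+ 2)%:E
   + \int[lebesgue_measure]_(t1 in `[0%R, +oo[)
      \int[lebesgue_measure]_(t2 in `[0%R, +oo[)
        (frobenius_norm (kernel2 S t1 t2 - kernel2 Sr t1 t2) ^+ 2)%:E)%E.

End LQO.

Definition local_minimizer {T : topologicalType} {d : Order.disp_t}
    {V : porderType d} (D : set T) (f : T -> V) (x : T) : Prop :=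
  D x /\ \forall y \near within D (nbhs x), (f x <= f y)%O.

(* Main.v *)
Require Import Defs.
From HB Require Import structures.
From mathcomp Require Import all_boot all_order all_algebra.
From mathcomp Require Import all_classical all_reals all_analysis.
From mathcomp Require Import complex mxtens ring lra.

Set Implicit Arguments.
Unset Strict Implicit.
Unset Printing Implicit Defensive.

Import Order.TTheory GRing.Theory Num.Theory.
Import numFieldNormedType.Exports.

Local Open Scope classical_set_scope.
Local Open Scope ring_scope.

(** The squared error is a smooth function of the reduced matrices near a
    stable system, so its gradient vanishes at a local minimizer; the theorem
    is what this says once the gradient has been computed.

    The difference of the kernels of two systems is the kernel of the error
    system, with state matrix diag(A, A_r), input matrix [B; B_r], output
    matrix [C, -C_r] and quadratic outputs diag(M_k, -M_(k,r)). If E(t) is the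
    exponential of the state matrix and P solves its Lyapunov equation
    A P + P A^T + B B^T = 0, then tr (H E(t) B B^T E(t)^T) has the
    antiderivative - tr (H E(t) P E(t)^T), which tends to 0 at infinity. One
    use of this for the linear kernel and two for the quadratic one give the
    closed form tr (C P C^T) + \sum_k tr (M_k P M_k^T P) of the squared error
    ([h2_error_sqE]).

    Stability enters through quadratic Lyapunov functions ([hurwitz_lyapunov]),
    built from the chain x, x (A - z_1), x (A - z_1) (A - z_2), ..., where the
    z_j are the eigenvalues; the chain ends at 0 by the Cayley-Hamilton
    theorem. Such a function makes the exponential decay, hence makes the
    Lyapunov equations uniquely solvable, and it certifies that a small
    perturbation of a stable matrix is stable ([hurwitz_perturb]), so that a
    minimizer may be tested along any line through it.

    Along a line, P depends differentiably on the parameter by Cramer's rule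
    ([lyapunov_family]). The derivative of P need not be computed: pairing its
    Lyapunov equation with the adjoint equation
    A^T Q + Q A + C^T C + 2 \sum_k M_k P M_k = 0 turns the terms that contain
    it into terms in Q ([first_variation]). Written in blocks, P has the blocks
    X and P_r, and Q has the blocks 2 Z - Z_1 and 2 Q_r - Q_(1,r); the four
    blocks of the gradient that belong to the reduced system are, up to sign
    and transposition, the left-hand sides of the optimality conditions
    ([first_order_conditions]). The
    projection formulas follow by linear algebra ([petrov_galerkin]). *)

(** * Entrywise differentiation of matrix-valued functions *)

(** Entrywise, so that the rules for products, traces and blocks are sums of
    scalar rules. *)
Definition is_derive_mx (R : realType) (a b : nat) (F : R -> 'M[R]_(a, b))
    (t : R) (dF : 'M[R]_(a, b)) : Prop :=
  forall i j, is_derive t 1 (fun s => F s i j) (dF i j).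

Section DeriveMx.
Variable R : realType.
Implicit Types t : R.

Lemma is_derive_mx_cst a b (A : 'M[R]_(a, b)) t :
  is_derive_mx (fun=> A) t 0.
Proof. by move=> i j; rewrite mxE; exact: is_derive_cst. Qed.

Lemma is_derive_mx_line a b (A D : 'M[R]_(a, b)) t :
  is_derive_mx (fun s => A + s *: D) t D.
Proof.
move=> i j; rewrite (_ : (fun s => _) = cst (A i j) + D i j \*: id); last first.
  by apply/funext => s; rewrite !mxE /= mulrC.
by apply: is_derive_eq; rewrite add0r /GRing.scale /= mulr1.
Qed.

Lemma is_derive_mxD a b (F G : R -> 'M[R]_(a, b)) t dF dG :
  is_derive_mx F t dF -> is_derive_mx G t dG ->
  is_derive_mx (fun s => F s + G s) t (dF + dG).
Proof.
move=> hF hG i j.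
rewrite (_ : (fun s => _) = (fun s => F s i j) + (fun s => G s i j)).
  by rewrite mxE; apply: is_deriveD.
by apply/funext => s; rewrite mxE.
Qed.

Lemma is_derive_mx_tr a b (F : R -> 'M[R]_(a, b)) t dF :
  is_derive_mx F t dF -> is_derive_mx (fun s => (F s)^T) t dF^T.
Proof.
move=> hF i j; rewrite mxE (_ : (fun s => _) = (fun s => F s j i)) //.
by apply/funext => s; rewrite mxE.
Qed.

Lemma is_derive_mxM a b c (F : R -> 'M[R]_(a, b)) (G : R -> 'M[R]_(b, c))
    t dF dG :
  is_derive_mx F t dF -> is_derive_mx G t dG ->
  is_derive_mx (fun s => F s *m G s) t (dF *m G t + F t *m dG).
Proof.
move=> hF hG i j.
rewrite (_ : (fun s => _) =
    \sum_(k < b) ((fun s => F s i k) * (fun s => G s k j))); last first.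
  by apply/funext => s; rewrite fct_sumE mxE.
apply: (is_derive_eq (is_derive_sum (fun k => is_deriveM (hF i k) (hG k j)))).
rewrite !mxE -big_split; apply: eq_bigr => k _ /=.
by rewrite addrC /GRing.scale /= [G t k j * _]mulrC.
Qed.

Lemma is_derive_mxMl a b c (A : 'M[R]_(a, b)) (F : R -> 'M[R]_(b, c)) t dF :
  is_derive_mx F t dF -> is_derive_mx (fun s => A *m F s) t (A *m dF).
Proof.
move=> hF; have := is_derive_mxM (is_derive_mx_cst A t) hF.
by rewrite mul0mx add0r.
Qed.

Lemma is_derive_mxMr a b c (A : 'M[R]_(b, c)) (F : R -> 'M[R]_(a, b)) t dF :
  is_derive_mx F t dF -> is_derive_mx (fun s => F s *m A) t (dF *m A).
Proof.
move=> hF; have := is_derive_mxM hF (is_derive_mx_cst A t).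
by rewrite mulmx0 addr0.
Qed.

Lemma is_derive_mxZ a b (f : R -> R) (F : R -> 'M[R]_(a, b)) t (df : R) dF :
  is_derive t 1 f df -> is_derive_mx F t dF ->
  is_derive_mx (fun s => f s *: F s) t (df *: F t + f t *: dF).
Proof.
move=> hf hF i j; rewrite (_ : (fun s => _) = f * (fun s => F s i j)).
  apply: (is_derive_eq (is_deriveM hf (hF i j))).
  by rewrite !mxE /GRing.scale /=; ring.
by apply/funext => s; rewrite mxE.
Qed.

Lemma is_derive_mxvec a b (F : R -> 'M[R]_(a, b)) t dF :
  is_derive_mx F t dF -> is_derive_mx (fun s => mxvec (F s)) t (mxvec dF).
Proof.
move=> hF i; rewrite (ord1 i) => k; case/mxvec_indexP: k => k l.
rewrite mxvecE (_ : (fun s => _) = fun s => F s k l) //.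
by apply/funext => s; rewrite mxvecE.
Qed.

Lemma is_derive_vec_mx a b (F : R -> 'rV[R]_(a * b)) t dF :
  is_derive_mx F t dF -> is_derive_mx (fun s => vec_mx (F s)) t (vec_mx dF).
Proof.
move=> hF i j.
rewrite mxE (_ : (fun s => _) = fun s => F s 0 (mxvec_index i j)) //.
by apply/funext => s; rewrite mxE.
Qed.

Lemma is_derive_mxtrace a (F : R -> 'M[R]_a) t dF :
  is_derive_mx F t dF -> is_derive t 1 (fun s => \tr (F s)) (\tr dF).
Proof.
move=> hF; rewrite (_ : (fun s => _) = \sum_(i < a) (fun s => F s i i)).
  exact: is_derive_sum.
by apply/funext => s; rewrite fct_sumE.
Qed.

Lemma is_derive_mx_block a b c d (F : R -> 'M[R]_(a, c))
    (G : R -> 'M[R]_(b, d)) t dF dG :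
  is_derive_mx F t dF -> is_derive_mx G t dG ->
  is_derive_mx (fun s => block_mx (F s) 0 0 (G s)) t (block_mx dF 0 0 dG).
Proof.
move=> hF hG i j; rewrite -(splitK i) -(splitK j).
case: (fintype.split i) => i'; case: (fintype.split j) => j' /=.
- rewrite block_mxEul (_ : (fun s => _) = fun s => F s i' j'); first exact: hF.
  by apply/funext => s; rewrite block_mxEul.
- rewrite block_mxEur mxE (_ : (fun s => _) = cst 0).
    exact: is_derive_cst.
  by apply/funext => s; rewrite block_mxEur mxE.
- rewrite block_mxEdl mxE (_ : (fun s => _) = cst 0).
    exact: is_derive_cst.
  by apply/funext => s; rewrite block_mxEdl mxE.
- rewrite block_mxEdr (_ : (fun s => _) = fun s => G s i' j'); first exact: hG.
  by apply/funext => s; rewrite block_mxEdr.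
Qed.

Lemma is_derive_derivable (f : R -> R) t (d : R) :
  is_derive t 1 f d -> derivable f t 1.
Proof. by case. Qed.

Lemma is_derive_continuous (f : R -> R) t (d : R) :
  is_derive t 1 f d -> {for t, continuous f}.
Proof.
by move=> /is_derive_derivable/derivable1_diffP/differentiable_continuous.
Qed.

Lemma is_derive0_cst (f : R -> R) :
  (forall t, is_derive t 1 f 0) -> forall s t, f s = f t.
Proof. by move=> hf s t; apply: is_derive_0_is_cst. Qed.

Lemma is_derive_mx0_cst a b (F : R -> 'M[R]_(a, b)) :
  (forall t, is_derive_mx F t 0) -> forall s t, F s = F t.
Proof.
move=> hF s t; apply/matrixP => i j.
apply: (@is_derive0_cst (fun s => F s i j)) => u.
by have := hF u i j; rewrite mxE.
Qed.

Lemma cvg_mxP (T : Type) (F : set_system T) (FF : Filter F) a b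
    (f : T -> 'M[R]_(a, b)) (L : 'M[R]_(a, b)) :
  (forall i j, f x i j @[x --> F] --> L i j) -> f x @[x --> F] --> L.
Proof.
move=> h; apply/cvgrPdist_le => /= e e0.
near=> x; rewrite [leLHS]/Num.Def.normr/= mx_normrE (bigmax_le _ (ltW e0))//=.
move=> k _; rewrite !mxE; move: k; near: x; apply: filter_forall => /= k.
by move: (h k.1 k.2) => /cvgrPdist_le /(_ _ e0).
Unshelve. all: by end_near. Qed.

End DeriveMx.

(** * The matrix exponential *)

Section Expmx.
Variables (R : realType) (n : nat) (A : 'M[R]_n).

Let K : R := n%:R * `|A| + 1.

Let le_entry (M : 'M[R]_n) i j : `|M i j| <= `|M|.
Proof.
rewrite [leRHS]/Num.Def.normr/= mx_normrE.
by apply: le_trans; last exact: (le_bigmax _ _ (i, j)).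
Qed.

Let K_ge0 : 0 <= K. Proof. by rewrite /K addr_ge0 // mulr_ge0. Qed.

Let exprmxZ (t : R) k : (t *: A) ^+ k = t ^+ k *: A ^+ k.
Proof.
elim: k => [|k IH]; first by rewrite !expr0 scale1r.
rewrite !exprS IH -[(t *: A) * _]/((t *: A) *m _) -scalemxAl -scalemxAr.
by rewrite scalerA.
Qed.

(** Geometric growth of the powers lets the exponential series of a number
    dominate every series met below. *)
Lemma normr_exp_entry_le k i j :
  `|(A ^+ k) i j| <= (n%:R * `|A| + 1) ^+ k.
Proof.
rewrite -/K; elim: k i j => [|k IH] i j.
  by rewrite expr0 mxE; case: eqP; rewrite ?normr1 ?normr0.
rewrite exprSr mxE (le_trans (ler_norm_sum _ _ _)) //.
rewrite (@le_trans _ _ (\sum_(l < n) K ^+ k * `|A|)) //.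
  by apply: ler_sum => l _; rewrite normrM ler_pM.
rewrite sumr_const card_ord -mulr_natl mulrCA exprSr ler_wpM2l ?exprn_ge0 //.
by rewrite /K lerDl.
Qed.

(* shifted coefficients: differentiating the series moves k to k + 1 *)
Let c k i j l : R := (l`!%:R)^-1 * (A ^+ (k + l)) i j.

Let c_diffs k i j : pseries_diffs (c k i j) = c k.+1 i j.
Proof.
apply/funext => l; rewrite /pseries_diffs /c addSnnS factS natrM invfM.
by rewrite !mulrA divff ?mul1r.
Qed.

Let c_cvg k i j x : cvgn (pseries (c k i j) x).
Proof.
have h : cvgn (series (fun l => K ^+ k * exp_coeff (K * `|x|) l)).
  exact/is_cvg_seriesZ/is_cvg_series_exp_coeff.
apply: normed_cvg; apply: series_le_cvg h => l //=.
  by rewrite mulr_ge0 ?exprn_ge0 // exp_coeff_ge0 // mulr_ge0.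
rewrite /c !normrM normfV normr_nat /exp_coeff normrX.
have -> : K ^+ k * ((K * `|x|) ^+ l / l`!%:R) =
    (l`!%:R)^-1 * K ^+ (k + l) * `|x| ^+ l by rewrite exprD exprMn; ring.
rewrite ler_wpM2r ?exprn_ge0 //.
by rewrite ler_wpM2l ?invr_ge0 // normr_exp_entry_le.
Qed.

Let expmx_entry t i j : expmx (t *: A) i j = limn (pseries (c 0 i j) t).
Proof.
have -> : expmx (t *: A) = \matrix_(i, j) limn (pseries (c 0 i j) t).
  apply: cvg_lim; first exact: norm_hausdorff.
  apply: cvg_mxP => i' j'; rewrite mxE.
  rewrite (_ : (fun x => _) = pseries (c 0 i' j') t); first exact: c_cvg.
  apply/funext => N; rewrite /series /= summxE; apply: eq_bigr => l _.
  by rewrite exprmxZ !mxE /c /=; ring.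
by rewrite mxE.
Qed.

Lemma expmx0 : expmx (0 *: A) = 1%:M.
Proof.
apply/matrixP => i j; rewrite expmx_entry; apply: lim_near_cst => //.
near=> N; rewrite /pseries /series /= -[N]prednK; last by near: N; exists 1%N.
rewrite big_nat_recl //= big1 ?addr0.
  by rewrite /c fact0 invr1 mul1r expr0 mulr1.
by move=> l _; rewrite expr0n /= mulr0.
Unshelve. all: by end_near. Qed.

Let expmx_diff t :
  is_derive_mx (fun s => expmx (s *: A)) t
    (\matrix_(i, j) limn (pseries (c 1 i j) t)).
Proof.
move=> i j; rewrite mxE.
rewrite (_ : (fun s => _) = fun s => limn (pseries (c 0 i j) s)).
  rewrite -c_diffs; apply: (@pseries_snd_diffs _ _ (`|t| + 1)).
  - exact: c_cvg.
  - rewrite c_diffs; exact: c_cvg.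
  - rewrite !c_diffs; exact: c_cvg.
  by rewrite [ltRHS]ger0_norm ?addr_ge0 // ltrDl.
by apply/funext => s; rewrite expmx_entry.
Qed.

Let lim_mulr (f : R ^nat) (a : R) :
  cvgn f -> limn (fun N => f N * a) = limn f * a.
Proof.
by move=> h; apply: cvg_lim => //; apply: cvgM => //; exact: cvg_cst.
Qed.

Let lim_sum (F : 'I_n -> R ^nat) :
  (forall k, cvgn (F k)) -> limn (fun N => \sum_k F k N) = \sum_k limn (F k).
Proof.
move=> h; apply: cvg_lim => //.
rewrite (_ : (fun N => _) = \sum_k F k); last first.
  by apply/funext => N; rewrite fct_sumE.
by elim/big_ind2 : _ => // [|u x v y]; [exact: cvg_cst|exact: cvgD].
Qed.

Lemma is_derive_expmxr t :
  is_derive_mx (fun s => expmx (s *: A)) t (expmx (t *: A) *m A).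
Proof.
have -> : expmx (t *: A) *m A = \matrix_(i, j) limn (pseries (c 1 i j) t).
  apply/matrixP => i j; rewrite !mxE.
  transitivity (\sum_k limn (fun N => pseries (c 0 i k) t N * A k j)).
    apply: eq_bigr => k _; rewrite expmx_entry -lim_mulr //; exact: c_cvg.
  rewrite -lim_sum; last first.
    by move=> k; apply: is_cvgM; [exact: c_cvg|exact: is_cvg_cst].
  congr (limn _); apply/funext => N; rewrite /pseries /series /=.
  under eq_bigr do rewrite big_distrl /=.
  rewrite exchange_big; apply: eq_bigr => l _ /=.
  rewrite /c add0n add1n exprSr mxE mulr_sumr mulr_suml.
  by apply: eq_bigr => k _; ring.
exact: expmx_diff.
Qed.

Lemma is_derive_expmxl t :
  is_derive_mx (fun s => expmx (s *: A)) t (A *m expmx (t *: A)).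
Proof.
have -> : A *m expmx (t *: A) = \matrix_(i, j) limn (pseries (c 1 i j) t).
  apply/matrixP => i j; rewrite !mxE.
  transitivity (\sum_k limn (fun N => pseries (c 0 k j) t N * A i k)).
    apply: eq_bigr => k _; rewrite expmx_entry mulrC -lim_mulr //; exact: c_cvg.
  rewrite -lim_sum; last first.
    by move=> k; apply: is_cvgM; [exact: c_cvg|exact: is_cvg_cst].
  congr (limn _); apply/funext => N; rewrite /pseries /series /=.
  under eq_bigr do rewrite big_distrl /=.
  rewrite exchange_big; apply: eq_bigr => l _ /=.
  rewrite /c add0n add1n exprS mxE mulr_sumr mulr_suml.
  by apply: eq_bigr => k _; ring.
exact: expmx_diff.
Qed.

End Expmx.

(** * Stable matrices and quadratic Lyapunov functions *)

Section Dot.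
Variable R : realType.

Definition dot n (u v : 'rV[R]_n) : R := (u *m v^T) 0 0.

Lemma dotE n (u v : 'rV[R]_n) : dot u v = \sum_i u 0 i * v 0 i.
Proof. by rewrite /dot mxE; apply: eq_bigr => i _; rewrite mxE. Qed.

Lemma dotC n (u v : 'rV[R]_n) : dot u v = dot v u.
Proof. by rewrite !dotE; apply: eq_bigr => i _; rewrite mulrC. Qed.

Lemma dotDl n (u v w : 'rV[R]_n) : dot (u + v) w = dot u w + dot v w.
Proof. by rewrite /dot mulmxDl mxE. Qed.

Lemma dotZl n a (u w : 'rV[R]_n) : dot (a *: u) w = a * dot u w.
Proof. by rewrite /dot -scalemxAl mxE. Qed.

Lemma dotDr n (u v w : 'rV[R]_n) : dot w (u + v) = dot w u + dot w v.
Proof. by rewrite dotC dotDl ![dot _ w]dotC. Qed.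

Lemma dotZr n a (u w : 'rV[R]_n) : dot w (a *: u) = a * dot w u.
Proof. by rewrite dotC dotZl dotC. Qed.

Lemma dotM n k (u : 'rV[R]_n) (M : 'M[R]_(n, k)) (v : 'rV[R]_k) :
  dot (u *m M) v = dot u (v *m M^T).
Proof. by rewrite /dot trmx_mul trmxK mulmxA. Qed.

Lemma dot_ge0 n (u : 'rV[R]_n) : 0 <= dot u u.
Proof. by rewrite dotE sumr_ge0 // => i _; rewrite -expr2 sqr_ge0. Qed.

Lemma dot_eq0 n (u : 'rV[R]_n) : (dot u u == 0) = (u == 0).
Proof.
apply/eqP/eqP => [|->]; last by rewrite /dot mul0mx mxE.
rewrite dotE => /psumr_eq0P h; apply/rowP => i; rewrite mxE.
have /h/(_ i isT) : forall i, true -> 0 <= u 0 i * u 0 i.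
  by move=> j _; rewrite -expr2 sqr_ge0.
by move/eqP; rewrite -expr2 sqrf_eq0 => /eqP.
Qed.

Lemma sqr_le_dot n (u : 'rV[R]_n) i : u 0 i ^+ 2 <= dot u u.
Proof.
rewrite dotE (bigD1 i) //= expr2 lerDl sumr_ge0 // => j _.
by rewrite -expr2 sqr_ge0.
Qed.

(** From [|e v - u|^2 >= 0]. *)
Lemma dot_young n (e : R) (u v : 'rV[R]_n) : 0 < e ->
  2 * dot u v <= e * dot v v + e^-1 * dot u u.
Proof.
move=> e0; have := dot_ge0 (e *: v - u).
rewrite -[- u]scaleN1r dotDl !dotDr !dotZl !dotZr (dotC v u) => h.
rewrite -(ler_pM2l e0) mulrDr mulrA [e * (e^-1 * _)]mulrA divff ?gt_eqF //.
by rewrite mul1r; lra.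
Qed.

Lemma normr_dotM_le n (M : 'M[R]_n) (x : 'rV[R]_n) :
  `|dot (x *m M) x| <= (\sum_i \sum_j `|M i j|) * dot x x.
Proof.
rewrite dotE exchange_big mulr_suml (le_trans (ler_norm_sum _ _ _)) //.
apply: ler_sum => j _; rewrite mxE mulr_suml mulr_suml.
rewrite (le_trans (ler_norm_sum _ _ _)) //; apply: ler_sum => i _.
rewrite !normrM mulrAC mulrC ler_wpM2l //.
have h1 := sqr_le_dot x i; have h2 := sqr_le_dot x j.
have := sqr_ge0 (`|x 0 i| - `|x 0 j|).
rewrite sqrrB !real_normK ?num_real // => h3.
rewrite mulr2n in h3; lra.
Qed.

End Dot.

(** The quadratic form of [P] dominates the norm and decays at rate [c] along
    [x' = x A]. *)
Definition lyapunov_form (R : realType) n (A P : 'M[R]_n) (c : R) : Prop :=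
  [/\ P^T = P, 0 < c,
      forall x : 'rV[R]_n, dot x x <= dot (x *m P) x
    & forall x : 'rV[R]_n,
        2 * dot (x *m A *m P) x <= - c * dot (x *m P) x].

Section Lyapunov.
Variable R : realType.
Local Notation toC := (map_mx (real_complex R)).
Local Notation re := (map_mx (@complex.Re R)).
Local Notation im := (map_mx (@complex.Im R)).

Let Re_mul_real (x : R) (z : R[i]) :
  complex.Re (real_complex R x * z) = x * complex.Re z.
Proof. by case: z => a b /=; rewrite mul0r subr0. Qed.

Let Im_mul_real (x : R) (z : R[i]) :
  complex.Im (real_complex R x * z) = x * complex.Im z.
Proof. by case: z => a b /=; rewrite mul0r addr0. Qed.

Let re_toC_mul n k l (A : 'M[R]_(n, k)) (Y : 'M[R[i]]_(k, l)) :
  re (toC A *m Y) = A *m re Y.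
Proof.
apply/matrixP => i j; rewrite !mxE raddf_sum; apply: eq_bigr => h _ /=.
by rewrite !mxE Re_mul_real.
Qed.

Let im_toC_mul n k l (A : 'M[R]_(n, k)) (Y : 'M[R[i]]_(k, l)) :
  im (toC A *m Y) = A *m im Y.
Proof.
apply/matrixP => i j; rewrite !mxE raddf_sum; apply: eq_bigr => h _ /=.
by rewrite !mxE Im_mul_real.
Qed.

Let re_mul_toC n k l (Y : 'M[R[i]]_(n, k)) (A : 'M[R]_(k, l)) :
  re (Y *m toC A) = re Y *m A.
Proof.
apply/matrixP => i j; rewrite !mxE raddf_sum; apply: eq_bigr => h _ /=.
by rewrite !mxE mulrC Re_mul_real mulrC.
Qed.

Let re_scale n k (z : R[i]) (Y : 'M[R[i]]_(n, k)) :
  re (z *: Y) = complex.Re z *: re Y - complex.Im z *: im Y.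
Proof. by apply/matrixP => i j; rewrite !mxE; case: z (Y i j) => a b []. Qed.

Let im_mul_toC n k l (Y : 'M[R[i]]_(n, k)) (A : 'M[R]_(k, l)) :
  im (Y *m toC A) = im Y *m A.
Proof.
apply/matrixP => i j; rewrite !mxE raddf_sum; apply: eq_bigr => h _ /=.
by rewrite !mxE mulrC Im_mul_real mulrC.
Qed.

Let im_scale n k (z : R[i]) (Y : 'M[R[i]]_(n, k)) :
  im (z *: Y) = complex.Re z *: im Y + complex.Im z *: re Y.
Proof. by apply/matrixP => i j; rewrite !mxE; case: z (Y i j) => a b []. Qed.

(** If [(A - z_k) ... (A - z_1) Y = 0] with all [z_j] in the open left
    half-plane, the vectors [y_j = x (A - z_j) ... (A - z_1) Y] obey
    [y_j' = z_(j+1) y_j + y_(j+1)] along [x' = x A], so that a sum of the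
    [|y_j|^2] with rapidly growing weights decays exponentially. *)
Lemma lyapunov_chain n (A : 'M[R]_n) (s : seq R[i]) (Y : 'M[R[i]]_n) :
  (forall z, z \in s -> complex.Re z < 0) ->
  foldl (fun Y z => (toC A - z%:M) *m Y) Y s = 0 ->
  exists P c, [/\ P^T = P, 0 < c,
    forall x : 'rV[R]_n,
      dot (x *m re Y) (x *m re Y) + dot (x *m im Y) (x *m im Y)
        <= dot (x *m P) x
  & forall x : 'rV[R]_n,
      2 * dot (x *m A *m P) x <= - c * dot (x *m P) x].
Proof.
elim: s Y => [|z s IH] Y /= hs.
  move=> ->; exists 0, 1; split => [|//|x|x]; first exact: trmx0.
    have -> : re 0 = 0 :> 'M[R]_n by apply/matrixP => i j; rewrite !mxE.
    have -> : im 0 = 0 :> 'M[R]_n by apply/matrixP => i j; rewrite !mxE.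
    by rewrite !mulmx0 /dot !mul0mx !mxE addr0.
  by rewrite !mulmx0 /dot !mul0mx !mxE !mulr0.
set Y1 := (toC A - z%:M) *m Y => /IH [|P [c [Psym c0 hP hA]]].
  by move=> w ws; apply: hs; rewrite inE ws orbT.
have : complex.Re z < 0 by apply: hs; rewrite inE eqxx.
set a := complex.Re z => a0; set b := complex.Im z.
set U := re Y; set V := im Y; set U1 := re Y1; set V1 := im Y1.
have AY : toC A *m Y = z *: Y + Y1.
  by rewrite /Y1 mulmxBl mul_scalar_mx addrC subrK.
have AU : A *m U = a *: U - b *: V + U1.
  by rewrite -re_toC_mul AY map_mxD re_scale.
have AV : A *m V = a *: V + b *: U + V1.
  by rewrite -im_toC_mul AY map_mxD im_scale.
pose N : 'M[R]_n := U *m U^T + V *m V^T.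
(* K is chosen so that half of the decay of the tail absorbs the coupling *)
pose K := 2 / (- a * c).
have na0 : 0 < - a by rewrite oppr_gt0.
have K0 : 0 < K by rewrite divr_gt0 // mulr_gt0.
have dotN (x y : 'rV[R]_n) :
    dot (x *m N) y = dot (x *m U) (y *m U) + dot (x *m V) (y *m V).
  by rewrite mulmxDr dotDl !mulmxA !dotM !trmxK.
have NT : N^T = N by rewrite linearD /= !trmx_mul !trmxK.
clearbody N; exists (N + K *: P), (Num.min (- a) (c / 2)); split.
- by rewrite linearD linearZ /= Psym NT.
- by rewrite lt_min na0 divr_gt0.
- move=> x; rewrite mulmxDr dotDl dotN lerDl -scalemxAr dotZl.
  by rewrite mulr_ge0 ?(ltW K0) // (le_trans _ (hP x)) // addr_ge0 ?dot_ge0.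
move=> x; rewrite !mulmxDr !dotDl -!scalemxAr !dotZl !dotN.
set q := dot (x *m U) _ + _.
have -> : dot (x *m A *m U) (x *m U) + dot (x *m A *m V) (x *m V) =
    a * q + (dot (x *m U1) (x *m U) + dot (x *m V1) (x *m V)).
  rewrite -!mulmxA AU AV !mulmxDr !dotDl mulmxN -!scalemxAr -scaleNr !dotZl.
  by rewrite (dotC (x *m V) (x *m U)) /q; ring.
have q0 : 0 <= q by rewrite addr_ge0 ?dot_ge0.
have y1 := dot_young (x *m U1) (x *m U) na0.
have y2 := dot_young (x *m V1) (x *m V) na0.
have /= hPx := hP x; have /= hAx := hA x.
rewrite -/U1 -/V1 in hPx.
set d1 := dot (x *m U1) _ in y1 *; set d2 := dot (x *m V1) _ in y2 *.
set p := dot (x *m P) x in hPx hAx *.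
set q1 := dot (x *m U1) _ in hPx y1; set q2 := dot (x *m V1) _ in hPx y2.
have p0 : 0 <= p by rewrite (le_trans _ hPx) // addr_ge0 ?dot_ge0.
have inv0 : 0 < (- a)^-1 by rewrite invr_gt0.
have yP : (- a)^-1 * (q1 + q2) <= (- a)^-1 * p by rewrite ler_wpM2l // ltW.
have hAK : K * (2 * dot (x *m A *m P) x) <= K * (- c * p).
  by rewrite ler_wpM2l // ltW.
have KcE : K * c = 2 * (- a)^-1.
  by rewrite /K; field; apply/andP; split; [exact: ltr0_neq0|exact: lt0r_neq0].
set mn := Num.min _ _.
have mn1 : mn <= - a.
  by rewrite /mn minElt; case: ifP => // /negbT; rewrite -leNgt.
have mn2 : mn <= c / 2 by rewrite /mn minElt; case: ifP => // /ltW.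
have h1 : mn * q <= - a * q by rewrite ler_wpM2r.
have h2 : mn * (K * p) <= c / 2 * (K * p).
  by apply: ler_wpM2r mn2; apply: mulr_ge0 => //; apply: ltW.
have h3 : c / 2 * (K * p) = (- a)^-1 * p.
  rewrite (_ : c / 2 * (K * p) = K * c * (p / 2)); last by field.
  by rewrite KcE; field; exact: ltr0_neq0.
have h4 : K * (- c * p) = - (2 * (- a)^-1 * p) by rewrite -KcE; ring.
have hq : q = dot (x *m U) (x *m U) + dot (x *m V) (x *m V) by [].
set du := dot (x *m U) (x *m U) in hq y1; set dv := dot (x *m V) _ in hq y2.
have h5 : - a * q = - a * du + - a * dv by rewrite hq mulrDr.
have h6 : (- a)^-1 * (q1 + q2) = (- a)^-1 * q1 + (- a)^-1 * q2.
  by rewrite mulrDr.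
move: (- a)^-1 y1 y2 yP h3 h4 h6 {inv0 KcE} => ia y1 y2 yP h3 h4 h6.
have -> : - mn * (q + K * p) = - (mn * q) - mn * (K * p) by ring.
rewrite h3 in h2; rewrite h4 in hAK.
have -> : 2 * (a * q + (d1 + d2) + K * dot (x *m A *m P) x) =
  - 2 * (- a * q) + 2 * d1 + 2 * d2 + K * (2 * dot (x *m A *m P) x) by ring.
move: (K * _) hAK => k1 hAK; move: (mn * _) (mn * _) h1 h2 => m1 m2 h1 h2.
move: (- a * q) h5 h1 => aq h5 h1; lra.
Qed.

(** Started at the identity, the chain over all eigenvalues ends at [0] by the
    Cayley-Hamilton theorem; its first term provides the lower bound. *)
Theorem hurwitz_lyapunov n (A : 'M[R]_n) :
  hurwitz A -> exists P c, lyapunov_form A P c.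
Proof.
case: n A => [|n] A hA.
  exists 0, 1; split => [|//|x|x]; first exact: trmx0.
    by rewrite [x]thinmx0 mul0mx.
  by rewrite !mulmx0 /dot !mul0mx !mxE !mulr0.
have [s hs] := closed_field_poly_normal (char_poly (toC A)).
rewrite (monicP (char_poly_monic _)) scale1r in hs.
have [|| P [c [Psym c0 hP hAP]]] := @lyapunov_chain _ A (rev s) 1.
- move=> z; rewrite mem_rev => zs; apply: hA.
  by rewrite eigenvalue_root_char hs root_prod_XsubC.
- rewrite foldl_rev.
  transitivity (\prod_(z <- s) (toC A - z%:M)).
    elim: s {hs} => [|z s IH]; first by rewrite big_nil.
    by rewrite big_cons /= IH.
  have := Cayley_Hamilton (toC A); rewrite hs rmorph_prod /= => <-.
  apply: eq_bigr => z _.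
  by rewrite rmorphB /= horner_mx_X horner_mx_C.
exists P, c; split=> // x; apply: le_trans (hP x).
have -> : re 1 = 1%:M :> 'M[R]_n.+1.
  by apply/matrixP => i j; rewrite !mxE; case: (i == j).
by rewrite mulmx1 lerDl dot_ge0.
Qed.

(** Apply the decay inequality to the real and imaginary parts of an
    eigenvector and add: the imaginary part of the eigenvalue cancels because
    [P] is symmetric. *)
Lemma lyapunov_hurwitz n (A P : 'M[R]_n) c :
  lyapunov_form A P c -> hurwitz A.
Proof.
move=> [Psym c0 hP hA] z /eigenvalueP [v hv v0].
set u := re v; set w := im v.
have hu : u *m A = complex.Re z *: u - complex.Im z *: w.
  by rewrite -re_scale -hv re_mul_toC.
have hw : w *m A = complex.Re z *: w + complex.Im z *: u.
  by rewrite -im_scale -hv im_mul_toC.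
have cross : dot (u *m P) w = dot (w *m P) u by rewrite dotM Psym dotC.
have hAu := hA u; have hAw := hA w.
rewrite hu -scaleNr mulmxDl dotDl -!scalemxAl !dotZl in hAu.
rewrite hw mulmxDl dotDl -!scalemxAl !dotZl cross in hAw.
have pos : 0 < dot (u *m P) u + dot (w *m P) w.
  apply: lt_le_trans (lerD (hP u) (hP w)).
  rewrite lt_def addr_ge0 ?dot_ge0 // andbT paddr_eq0 ?dot_ge0 // !dot_eq0.
  apply: contra v0 => /andP[/eqP hu0 /eqP hw0]; apply/eqP/rowP => i.
  have := congr1 (fun m : 'rV_n => m 0 i) hu0.
  have := congr1 (fun m : 'rV_n => m 0 i) hw0.
  by rewrite !mxE; case: (v 0 i) => a b /= -> ->.
rewrite -(pmulr_llt0 _ pos).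
have h : - c * (dot (u *m P) u + dot (w *m P) w) < 0.
  by rewrite mulNr oppr_lt0 mulr_gt0.
rewrite mulrDr; rewrite mulrDr in h.
set d := dot (w *m P) u in hAu hAw; lra.
Qed.

(** Stability survives small perturbations: the quadratic Lyapunov function
    of the unperturbed matrix still decays. *)
Lemma hurwitz_perturb n (A D : 'M[R]_n) : hurwitz A ->
  exists2 d, 0 < d & forall e : R, `|e| < d -> hurwitz (A + e *: D).
Proof.
move=> /hurwitz_lyapunov [P [c [Psym c0 hP hA]]].
pose k := \sum_i \sum_j `|(D *m P) i j|.
have k0 : 0 <= k by do 2![apply: sumr_ge0 => ? _].
exists (c / (4 * (k + 1))); first by rewrite divr_gt0 // mulr_gt0 // ltr_wpDl.
move=> e he; apply: (@lyapunov_hurwitz _ _ P (c / 2)); split => //.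
  by rewrite divr_gt0.
move=> x; rewrite mulmxDr mulmxDl dotDl mulrDr -!scalemxAr -scalemxAl dotZl.
have h1 := hA x; have h2 := hP x.
have h3 : e * dot (x *m D *m P) x <= `|e| * (k * dot x x).
  rewrite (le_trans (ler_norm _)) // normrM ler_wpM2l // -mulmxA.
  exact: normr_dotM_le.
have h4 : `|e| * (k * dot x x) <= c / 4 * dot x x.
  rewrite mulrA ler_wpM2r ?dot_ge0 //.
  rewrite (@le_trans _ _ (`|e| * (k + 1))) ?ler_wpM2l ?lerDl //.
  move/ltW: he; rewrite ler_pdivlMr ?mulr_gt0 ?ltr_wpDl // => he; lra.
have h5 : c / 4 * dot x x <= c / 4 * dot (x *m P) x.
  by rewrite ler_wpM2l // divr_ge0 // ltW.
have -> : - (c / 2) * dot (x *m P) x =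
  - c * dot (x *m P) x + 2 * (c / 4 * dot (x *m P) x) by field.
lra.
Qed.

End Lyapunov.

(** * Stable flows, Lyapunov equations and Gramians *)

Section CvgMx.
Variables (R : realType) (T : Type) (F : set_system T).
Context {FF : Filter F}.

Lemma cvg_fct_sum (I : Type) (s : seq I) (f : I -> T -> R) (l : I -> R) :
  (forall i, f i x @[x --> F] --> l i) ->
  (\sum_(i <- s) f i x) @[x --> F] --> \sum_(i <- s) l i.
Proof.
move=> h; rewrite (_ : (fun x => _) = \sum_(i <- s) f i); last first.
  by apply/funext => x; rewrite fct_sumE.
by elim/big_ind2 : _ => // [|u x v y]; [exact: cvg_cst|exact: cvgD].
Qed.

Lemma cvg_coord_mulmx a b c (f : T -> 'M[R]_(a, b)) (g : T -> 'M[R]_(b, c))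
    (L : 'M[R]_(a, b)) (M : 'M[R]_(b, c)) :
  (forall i j, f x i j @[x --> F] --> L i j) ->
  (forall i j, g x i j @[x --> F] --> M i j) ->
  forall i j, (f x *m g x) i j @[x --> F] --> (L *m M) i j.
Proof.
move=> hf hg i j; rewrite mxE (_ : (fun x => _) =
  fun x => \sum_k f x i k * g x k j); last by apply/funext => x; rewrite mxE.
by apply: cvg_fct_sum => k; apply: cvgM.
Qed.

Lemma cvg_coord_tr a b (f : T -> 'M[R]_(a, b)) (L : 'M[R]_(a, b)) :
  (forall i j, f x i j @[x --> F] --> L i j) ->
  forall i j, (f x)^T i j @[x --> F] --> L^T i j.
Proof.
move=> hf i j; rewrite mxE (_ : (fun x => _) = fun x => f x j i) //.
by apply/funext => x; rewrite mxE.
Qed.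

Lemma cvg_mxtrace a (f : T -> 'M[R]_a) (L : 'M[R]_a) :
  (forall i j, f x i j @[x --> F] --> L i j) ->
  \tr (f x) @[x --> F] --> \tr L.
Proof. by move=> hf; apply: cvg_fct_sum => i. Qed.

End CvgMx.

(** The properties of [t |-> exp (t A)] for a stable [A] that matter here.
    Unlike the power series, they pass at once to block diagonal matrices. *)
Record stable_flow (R : realType) n (A : 'M[R]_n) (E : R -> 'M[R]_n) : Prop :=
  StableFlow {
    flow0 : E 0 = 1%:M;
    flow_derivr : forall t, is_derive_mx E t (E t *m A);
    flow_derivl : forall t, is_derive_mx E t (A *m E t);
    flow_cvg0 : forall i j, E t i j @[t --> +oo] --> (0 : R) }.

Section Flow.
Variable R : realType.

(** [f t * expR (c t)] is nonincreasing. *)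
Lemma gronwall_cvg0 (f df : R -> R) (c : R) : 0 < c ->
  (forall t, 0 <= f t) -> (forall t : R, is_derive t 1 f (df t)) ->
  (forall t, df t <= - c * f t) -> f t @[t --> +oo] --> 0.
Proof.
move=> c0 f0 hdf hle.
pose g (t : R) := f t * expR (c * t).
have hg (t : R) : is_derive t 1 g (expR (c * t) * (df t + c * f t)).
  have he : is_derive t 1 (fun s => expR (c * s)) (c * expR (c * t)).
    have -> : (fun s => expR (c * s)) = expR \o (c \*: id) by [].
    have hl : is_derive t 1 (c \*: id) c.
      by apply: is_derive_eq; rewrite /GRing.scale /= mulr1.
    apply: (is_derive_eq (is_derive1_comp (is_derive_expR _) hl)).
    by rewrite /GRing.scale /= mulrC.
  apply: (is_derive_eq (is_deriveM (hdf t) he)).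
  by rewrite /GRing.scale /=; ring.
have gdec (t : R) : 0 <= t -> g t <= g 0.
  move=> t0; apply: (@ler0_derive1_le R g 0 t _ _ true false) => //.
  - move=> x _; rewrite derive1E (@derive_val _ _ _ _ _ _ _ (hg x)).
    by rewrite pmulr_rle0 ?expR_gt0 //; have := hle x; lra.
  - apply: continuous_subspaceT => x; exact: is_derive_continuous (hg x).
  - by rewrite in_itv /= lexx t0.
  - by rewrite in_itv /= lexx t0.
apply: (@squeeze_cvgr _ _ _ _ (cst 0) (fun t => f 0 * expR (- (c * t)))).
- near=> t; rewrite f0 /=.
  have t0 : 0 <= t by near: t; apply: nbhs_pinfty_ge; exact: num_real.
  have := gdec t t0; rewrite /g mulr0 expR0 mulr1 => h.
  by rewrite expRN ler_pdivlMr ?expR_gt0.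
- exact: cvg_cst.
rewrite -[X in _ --> X](mulr0 (f 0)); apply: cvgM; first exact: cvg_cst.
apply: (cvg_comp (fun t => c * t) (fun x => expR (- x)) _ (@cvgr_expR R)).
apply/cvgryPge => A; near=> t.
by rewrite mulrC -ler_pdivrMr.
Unshelve. all: by end_near. Qed.

(** Each row of the exponential is a trajectory of [x' = x A], along which a
    Lyapunov function decays and dominates the squared entries. *)
Lemma stable_flow_expmx n (A : 'M[R]_n) :
  hurwitz A -> stable_flow A (fun t => expmx (t *: A)).
Proof.
move=> /hurwitz_lyapunov [P [c [Psym c0 hP hA]]].
set E := fun t => _; have dE t : is_derive_mx E t (E t *m A).
  exact: is_derive_expmxr.
split=> //; [exact: expmx0|exact: is_derive_expmxl|move=> i j].
pose x : 'rV[R]_n := delta_mx 0 i.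
pose f t := dot (x *m E t *m P) (x *m E t).
have hf : f t @[t --> +oo] --> 0.
  apply: (@gronwall_cvg0 f
    (fun t => 2 * dot (x *m E t *m A *m P) (x *m E t)) c) => // t.
  - by apply: le_trans (hP _); exact: dot_ge0.
  - have d1 := is_derive_mxMl x (dE t).
    have := is_derive_mxM (is_derive_mxMr P d1) (is_derive_mx_tr d1).
    move=> /(_ 0 0) d2; apply: (is_derive_eq d2).
    set y := x *m E t; rewrite mulmxA -/y mxE.
    rewrite -[(_ *m y^T) 0 0]/(dot (y *m A *m P) y).
    rewrite -[X in _ + X]/(dot (y *m P) (y *m A)) (dotC (y *m P)).
    by rewrite [in RHS]mulr_natl mulr2n [dot (y *m A *m P) y]dotM Psym.
have hE : E t i j ^+ 2 @[t --> +oo] --> 0.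
  apply: (@squeeze_cvgr _ _ _ _ (cst 0) f) hf; last exact: cvg_cst.
  near=> t; rewrite sqr_ge0 /=; apply: le_trans (hP _).
  apply: le_trans (sqr_le_dot _ j).
  by rewrite /x -rowE mxE.
apply/cvgr0Pnorm_lt => e e0.
move/cvgr0Pnorm_lt: hE => /(_ (e ^+ 2)); rewrite exprn_gt0 // => /(_ isT).
apply: filterS => t; rewrite normrX ltr_pXn2r //; exact: ltW.
Unshelve. all: by end_near. Qed.

Lemma stable_flow_tr n (A : 'M[R]_n) E :
  stable_flow A E -> stable_flow A^T (fun t => (E t)^T).
Proof.
case=> h0 hr hl hc; split=> [|t|t|i j].
- by rewrite h0 trmx1.
- by rewrite -trmx_mul; apply: is_derive_mx_tr.
- by rewrite -trmx_mul; apply: is_derive_mx_tr.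
rewrite (_ : (fun t => _) = (fun t => E t j i)) //.
by apply/funext => t; rewrite mxE.
Qed.

Lemma stable_flow_block n r (A : 'M[R]_n) (B : 'M[R]_r) E F :
  stable_flow A E -> stable_flow B F ->
  stable_flow (block_mx A 0 0 B) (fun t => block_mx (E t) 0 0 (F t)).
Proof.
case=> E0 Er El Ec [F0 Fr Fl Fc]; split=> [|t|t|i j].
- by rewrite E0 F0 -scalar_mx_block.
- rewrite mulmx_block !mulmx0 !mul0mx !addr0 add0r.
  exact: is_derive_mx_block.
- rewrite mulmx_block !mulmx0 !mul0mx !addr0 add0r.
  exact: is_derive_mx_block.
rewrite -(splitK i) -(splitK j).
case: (fintype.split i) => i'; case: (fintype.split j) => j' /=.
- rewrite (_ : (fun s => _) = fun t => E t i' j') //.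
  by apply/funext => t; rewrite block_mxEul.
- rewrite (_ : (fun s => _) = cst 0); first exact: cvg_cst.
  by apply/funext => t; rewrite block_mxEur mxE.
- rewrite (_ : (fun s => _) = cst 0); first exact: cvg_cst.
  by apply/funext => t; rewrite block_mxEdl mxE.
rewrite (_ : (fun s => _) = fun t => F t i' j') //.
by apply/funext => t; rewrite block_mxEdr.
Qed.

Section Lyap.
Variables (n : nat) (A : 'M[R]_n) (E : R -> 'M[R]_n).
Hypothesis flowE : stable_flow A E.

Let congr_cvg0 (P : 'M[R]_n) i j :
  (E t *m P *m (E t)^T) i j @[t --> +oo] --> (0 : R).
Proof.
have h0 k l : E t k l @[t --> +oo] --> (0 : 'M[R]_n) k l.
  by rewrite mxE; exact: flow_cvg0 flowE k l.
have := cvg_coord_mulmx (cvg_coord_mulmx h0 (fun k l => cvg_cst (P k l)))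
  (cvg_coord_tr h0) => /(_ _ _ _ i j).
by rewrite !mul0mx mxE.
Qed.

Let congr_deriv (P : 'M[R]_n) t :
  is_derive_mx (fun t => E t *m P *m (E t)^T) t
    (E t *m (A *m P + P *m A^T) *m (E t)^T).
Proof.
have dE := flow_derivr flowE t.
have := is_derive_mxM (is_derive_mxMr P dE) (is_derive_mx_tr dE).
by rewrite mulmxDr mulmxDl trmx_mul !mulmxA.
Qed.

(** Along the flow, [E D E^T] is constant and tends to [0]. *)
Lemma lyapunov_eq0 (D : 'M[R]_n) : A *m D + D *m A^T = 0 -> D = 0.
Proof.
move=> hD; pose F t := E t *m D *m (E t)^T.
have F0 t : F t = D.
  rewrite (@is_derive_mx0_cst _ _ _ F _ t 0).
    by rewrite /F (flow0 flowE) trmx1 mul1mx mulmx1.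
  by move=> s; have := congr_deriv D s; rewrite hD mulmx0 mul0mx.
apply/matrixP => i j; rewrite mxE.
have := congr_cvg0 D i j; rewrite (_ : (fun t => _) = cst (D i j)); last first.
  by apply/funext => t; rewrite -[_ *m _]/(F t) F0.
by move=> /(cvg_lim (@norm_hausdorff _ _)) <-; rewrite lim_cst.
Qed.

Lemma lyapunov_unique (W P1 P2 : 'M[R]_n) :
  A *m P1 + P1 *m A^T + W = 0 -> A *m P2 + P2 *m A^T + W = 0 -> P1 = P2.
Proof.
move=> h1 h2; apply/eqP; rewrite -subr_eq0; apply/eqP/lyapunov_eq0.
rewrite mulmxBr mulmxBl addrACA -opprD.
by rewrite -[X in X - _](addrK W) h1 -[X in _ - X](addrK W) h2 subrr.
Qed.

Lemma lyapunov_sym (W P : 'M[R]_n) : W^T = W ->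
  A *m P + P *m A^T + W = 0 -> P^T = P.
Proof.
move=> hW h; apply: (lyapunov_unique _ h).
have := congr1 trmx h; rewrite !linearD /= !trmx_mul trmxK hW trmx0 => <-.
by rewrite [X in X + W]addrC.
Qed.

(** The integrand is the derivative of [- tr (H E P E^T)], which starts at
    [- tr (H P)] and tends to [0]. *)
Lemma integral_congr_flow (H W P : 'M[R]_n) :
  A *m P + P *m A^T + W = 0 ->
  (forall t, 0 <= \tr (H *m (E t *m W *m (E t)^T))) ->
  (\int[lebesgue_measure]_(t in `[0%R, +oo[)
     (\tr (H *m (E t *m W *m (E t)^T)))%:E = (\tr (H *m P))%:E)%E.
Proof.
move=> hP h0.
pose F t := - \tr (H *m (E t *m P *m (E t)^T)).
pose f t := \tr (H *m (E t *m W *m (E t)^T)).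
have dF (t : R) : is_derive t 1 F (f t).
  have := is_deriveN (is_derive_mxtrace (is_derive_mxMl H (congr_deriv P t))).
  rewrite (_ : A *m P + P *m A^T = - W); last first.
    by apply/eqP; rewrite -addr_eq0 hP.
  by rewrite mulmxN mulNmx mulmxN linearN opprK.
have cf (t : R) : {for t, continuous f}.
  exact: is_derive_continuous (is_derive_mxtrace
    (is_derive_mxMl H (congr_deriv W t))).
have cF (t : R) : {for t, continuous F}.
  exact: is_derive_continuous (dF t).
rewrite (@ge0_continuous_FTC2y R f F 0 0) //.
- by rewrite /F (flow0 flowE) trmx1 mul1mx mulmx1 sub0e EFinN oppeK.
- by move=> t _; exact: h0.
- by apply: continuous_subspaceT => t; exact: cf.
- rewrite -oppr0; apply: cvgN.
  rewrite -(mxtrace0 R n) -(mulmx0 n H).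
  apply: cvg_mxtrace; apply: cvg_coord_mulmx => i j; first exact: cvg_cst.
  by rewrite mxE; exact: congr_cvg0.
- by apply: cvg_at_right_filter; exact: cF.
by move=> t _; rewrite derive1E (@derive_val _ _ _ _ _ _ _ (dF t)).
Qed.

End Lyap.

(** The operator [X |-> A X + X A^T] acting on vectorized matrices. *)
Definition lyapunov_mx n (A : 'M[R]_n) : 'M[R]_(n * n) :=
  lin_mulmx A + lin_mulmxr A^T.

Lemma mxvec_lyapunov n (A X : 'M[R]_n) :
  mxvec X *m lyapunov_mx A = mxvec (A *m X + X *m A^T).
Proof. by rewrite mulmxDr !mul_vec_lin linearD. Qed.

Lemma lyapunov_mx_unit n (A : 'M[R]_n) E :
  stable_flow A E -> lyapunov_mx A \in unitmx.
Proof.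
move=> flowE; rewrite -row_free_unit -kermx_eq0; apply/eqP/row_matrixP => i.
rewrite row0; set u := row i _.
have : u *m lyapunov_mx A = 0 by rewrite -row_mul mulmx_ker row0.
rewrite -[u]vec_mxK mxvec_lyapunov => /(congr1 vec_mx).
by rewrite mxvecK linear0 => /(lyapunov_eq0 flowE) ->; rewrite linear0.
Qed.

Lemma lyapunov_exists n (A W : 'M[R]_n) E :
  stable_flow A E -> exists P, A *m P + P *m A^T + W = 0.
Proof.
move=> /lyapunov_mx_unit uA.
exists (vec_mx (- mxvec W *m invmx (lyapunov_mx A))).
apply: (can_inj mxvecK); rewrite linearD /= -mxvec_lyapunov vec_mxK.
by rewrite mulmxKV // addNr linear0.
Qed.

End Flow.

(** * Closed form of the error *)

Lemma index_allpairs_pair (S T : eqType) (s : seq S) (t : seq T) x y :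
  x \in s -> y \in t ->
  index (x, y) [seq (x', y') | x' <- s, y' <- t]
    = (index x s * size t + index y t)%N.
Proof.
move=> + yt; elim: s => //= z s IH; rewrite inE index_cat size_map.
have [->|nxz] := eqVneq x z.
  by move=> _; rewrite map_f // ?eqxx index_map // => ? ? [].
move=> /= /IH ->.
case: ifP => [/mapP[y' _ [xz _]]|_]; first by rewrite xz eqxx in nxz.
by rewrite mulSn addnA.
Qed.

(** Both indexings of pairs are lexicographic. *)
Lemma mxvec_index_mxtens n m (i : 'I_n) (j : 'I_m) :
  mxvec_index i j = mxtens_index (i, j).
Proof.
apply: val_inj; rewrite /= /enum_rank enum_rank_in.unlock insubdK; last first.
  by rewrite unfold_in cardE index_mem mem_enum.
rewrite enumT unlock /= /prod_enum index_allpairs_pair ?mem_enum //.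
by rewrite !index_enum_ord size_enum_ord.
Qed.

Section ErrorFormula.
Variable R : realType.

Lemma frobenius_norm_sq a b (A : 'M[R]_(a, b)) :
  frobenius_norm A ^+ 2 = \tr (A *m A^T).
Proof.
rewrite sqr_sqrtr; last by do 2![apply: sumr_ge0 => ? _]; exact: sqr_ge0.
apply: eq_bigr => i _; rewrite mxE; apply: eq_bigr => j _.
by rewrite mxE expr2.
Qed.

Lemma mxtrace_gram_ge0 a b (A : 'M[R]_(a, b)) : 0 <= \tr (A *m A^T).
Proof. by rewrite -frobenius_norm_sq sqr_ge0. Qed.

Lemma sum_mxtens_index a b (F : 'I_(a * b) -> R) :
  \sum_l F l = \sum_i \sum_j F (mxtens_index (i, j)).
Proof.
rewrite pair_bigA /= (reindex (@mxtens_index a b)) /=; last first.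
  exists (@mxtens_unindex a b) => k _; first exact: mxtens_indexK.
  exact: mxtens_unindexK.
by apply: eq_bigr => -[].
Qed.

(** The Kronecker form of the quadratic kernel collects bilinear forms in the
    [M_k]; the indices [a] and [b] swap because [vec] stacks columns. *)
Lemma quad_mx_tensE n m p (S : lqo R n m p) (G1 G2 : 'M[R]_(n, m)) k a b :
  (quad_mx S *m (G1 *t G2)) k (mxtens_index (a, b))
    = (G2^T *m lqoM S k *m G1) b a.
Proof.
rewrite mxE sum_mxtens_index mxE; apply: eq_bigr => i _.
rewrite mxE mulr_suml; apply: eq_bigr => j _.
by rewrite tensmxE !mxE -mxvec_index_mxtens mxvecE !mxE; ring.
Qed.

Section ErrorSystem.
Variables (n r m p : nat).
Variables (A : 'M[R]_n) (B : 'M[R]_(n, m)) (C : 'M[R]_(p, n)).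
Variable M : 'I_p -> 'M[R]_n.
Variables (Ar : 'M[R]_r) (Br : 'M[R]_(r, m)) (Cr : 'M[R]_(p, r)).
Variable Mr : 'I_p -> 'M[R]_r.

Let S : lqo R n m p := (A, B, C, M).
Let Sr : lqo R r m p := (Ar, Br, Cr, Mr).
Let Ae := block_mx A 0 0 Ar.
Let Be := col_mx B Br.
Let Ce := row_mx C (- Cr).
Let Me k := block_mx (M k) 0 0 (- Mr k).
Let E (t : R) := block_mx (expmx (t *: A)) 0 0 (expmx (t *: Ar)).
Let G t := E t *m (Be *m Be^T) *m (E t)^T.

Let kernel1_errE t :
  frobenius_norm (kernel1 S t - kernel1 Sr t) ^+ 2 = \tr (Ce^T *m Ce *m G t).
Proof.
have -> : kernel1 S t - kernel1 Sr t = Ce *m E t *m Be.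
  rewrite /kernel1 /lqoA /lqoB /lqoC /= /Ce /E /Be mul_row_block.
  by rewrite !mulmx0 addr0 add0r mul_row_col !mulNmx.
rewrite frobenius_norm_sq !trmx_mul /G !mulmxA.
by rewrite [LHS]mxtrace_mulC !mulmxA.
Qed.

Let kernel2_errE t1 t2 :
  frobenius_norm (kernel2 S t1 t2 - kernel2 Sr t1 t2) ^+ 2
    = \tr ((\sum_k Me k *m G t1 *m (Me k)^T) *m G t2).
Proof.
pose D k := (E t2 *m Be)^T *m Me k *m (E t1 *m Be).
transitivity (\sum_k \tr (D k *m (D k)^T)).
  rewrite /frobenius_norm sqr_sqrtr; last first.
    by do 2![apply: sumr_ge0 => ? _]; exact: sqr_ge0.
  apply: eq_bigr => k _; rewrite sum_mxtens_index exchange_big.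
  apply: eq_bigr => b _; rewrite mxE; apply: eq_bigr => a _.
  rewrite mxE [X in _ + X]mxE /kernel2 !quad_mx_tensE [X in _ * X]mxE.
  rewrite /lqoA /lqoB /lqoM /=.
  rewrite -expr2; congr (_ ^+ 2); rewrite /D /E /Be /Me.
  rewrite !mul_block_col !mul0mx !addr0 !add0r tr_col_mx mul_row_block.
  by rewrite !mulmx0 !addr0 !add0r mul_row_col mulmxN mulNmx !mxE.
rewrite mulmx_suml linear_sum /=; apply: eq_bigr => k _.
have -> : D k *m (D k)^T = (E t2 *m Be)^T *m
    (Me k *m G t1 *m (Me k)^T *m (E t2 *m Be)).
  rewrite /D /G; move: (E t1) (E t2) (Me k) Be => E1 E2 K F.
  by rewrite !trmx_mul !trmxK !mulmxA.
rewrite mxtrace_mulC /G; move: (E t1) (E t2) (Me k) Be => E1 E2 K F.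
by rewrite trmx_mul !mulmxA.
Qed.

(** The inner integral replaces one of the two factors [E B B^T E^T] of the
    quadratic kernel by [P], the outer integral the other. *)
Lemma h2_error_sqE (P : 'M[R]_(n + r)) :
  hurwitz A -> hurwitz Ar ->
  Ae *m P + P *m Ae^T + Be *m Be^T = 0 ->
  h2_error_sq S Sr =
    (\tr (Ce *m P *m Ce^T) + \sum_k \tr (Me k *m P *m (Me k)^T *m P))%:E.
Proof.
move=> hA hAr hP.
have flowE : stable_flow Ae E.
  by apply: stable_flow_block; exact: stable_flow_expmx.
have k1ge t : 0 <= \tr (Ce^T *m Ce *m G t).
  by rewrite -kernel1_errE sqr_ge0.
have k2ge t1 t2 : 0 <= \tr ((\sum_k Me k *m G t1 *m (Me k)^T) *m G t2).
  by rewrite -kernel2_errE sqr_ge0.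
pose H2 := \sum_k (Me k)^T *m P *m Me k.
have inner t1 : (\int[lebesgue_measure]_(t2 in `[0%R, +oo[)
    (frobenius_norm (kernel2 S t1 t2 - kernel2 Sr t1 t2) ^+ 2)%:E
    = (\tr (H2 *m G t1))%:E)%E.
  under eq_integral do rewrite kernel2_errE.
  rewrite (integral_congr_flow flowE hP (k2ge t1)); congr (_%:E).
  rewrite !mulmx_suml !linear_sum /=; apply: eq_bigr => k _.
  by rewrite -mulmxA mxtrace_mulC !mulmxA.
have H2ge t : 0 <= \tr (H2 *m G t).
  rewrite -lee_fin -inner; apply: integral_ge0 => t2 _.
  by rewrite lee_fin sqr_ge0.
rewrite /h2_error_sq.
under eq_integral do rewrite kernel1_errE.
rewrite (integral_congr_flow flowE hP k1ge).
under eq_integral do rewrite inner.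
rewrite (integral_congr_flow flowE hP H2ge) -EFinD; congr (_ + _)%:E.
  by rewrite -mulmxA mxtrace_mulC.
rewrite mulmx_suml linear_sum /=; apply: eq_bigr => k _.
by rewrite -mulmxA mxtrace_mulC !mulmxA.
Qed.

End ErrorSystem.
End ErrorFormula.

(** * First variation of the error *)

Section Perturbation.
Variables (R : realType) (n : nat).
Variables (A dA : 'M[R]_n).

Let L (e : R) := lyapunov_mx A + e *: lyapunov_mx dA.
(* polynomial in the perturbation parameter, so that its determinant and
   adjugate are differentiable for free *)
Let Lp : 'M[{poly R}]_(n * n) :=
  \matrix_(i, j) ((lyapunov_mx A i j)%:P + lyapunov_mx dA i j *: 'X).

Let L_horner e : L e = map_mx (horner_eval e) Lp.
Proof.
apply/matrixP => i j; rewrite !mxE /horner_eval hornerD hornerC hornerZ hornerX.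
by rewrite mulrC.
Qed.

Let det_L e : \det (L e) = (\det Lp).[e].
Proof. by rewrite L_horner det_map_mx. Qed.

Let adj_L e : \adj (L e) = map_mx (horner_eval e) (\adj Lp).
Proof. by rewrite L_horner map_mx_adj. Qed.

(** By Cramer's rule the solution is a rational function of the perturbation
    parameter, applied to the right-hand side. *)
Lemma lyapunov_family (W : R -> 'M[R]_n) dW :
  lyapunov_mx A \in unitmx -> is_derive_mx W 0 dW ->
  exists P dP, is_derive_mx P 0 dP /\
    \forall e \near (0 : R), (A + e *: dA) *m P e + P e *m (A + e *: dA)^T
      + W e = 0.
Proof.
move=> uA hW.
have d0 : (\det Lp).[0] != 0.
  by rewrite -det_L /L scale0r addr0 -unitfE -unitmxE.
pose P e := vec_mx ((- (\det Lp).[e]^-1) *: (mxvec (W e) *m \adj (L e))).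
have dadj : is_derive_mx (fun e => \adj (L e)) 0
    (map_mx (fun q => q^`().[0]) (\adj Lp)).
  move=> i j; rewrite mxE.
  rewrite (_ : (fun s => _) = horner (\adj Lp i j)).
    exact: is_derive_poly.
  by apply/funext => s; rewrite adj_L mxE.
have ddet := is_deriveN (is_deriveV d0 (is_derive_poly (\det Lp) 0)).
have dP := is_derive_vec_mx (is_derive_mxZ ddet
  (is_derive_mxM (is_derive_mxvec hW) dadj)).
exists P; eexists; split; first exact: dP.
have : \forall e \near (0 : R), (\det Lp).[e] != 0.
  have hc : (\det Lp).[e] @[e --> (0 : R)] --> (\det Lp).[0].
    exact: continuous_horner.
  exact: (cvgr_neq0 _ hc d0).
apply: filterS => e de; apply: (can_inj mxvecK); rewrite linear0 linearD /=.
have -> : mxvec ((A + e *: dA) *m P e + P e *m (A + e *: dA)^T) =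
    mxvec (P e) *m L e.
  rewrite /L mulmxDr -scalemxAr !mxvec_lyapunov -linearZ -linearD /=.
  congr mxvec; rewrite linearD linearZ /= mulmxDl mulmxDr -scalemxAl -scalemxAr.
  by rewrite scalerDr addrACA.
rewrite /P vec_mxK -scalemxAl -mulmxA mul_adj_mx det_L mul_mx_scalar scalerA.
by rewrite mulNr mulVf // scaleN1r addNr.
Qed.

Lemma lyapunov_family_derive (W P : R -> 'M[R]_n) dW dP :
  is_derive_mx W 0 dW -> is_derive_mx P 0 dP ->
  (\forall e \near (0 : R), (A + e *: dA) *m P e + P e *m (A + e *: dA)^T
      + W e = 0) ->
  A *m dP + dP *m A^T + (dA *m P 0 + P 0 *m dA^T + dW) = 0.
Proof.
move=> hW hP h0.
have dL := is_derive_mx_line A dA 0.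
have := is_derive_mxD (is_derive_mxD (is_derive_mxM dL hP)
  (is_derive_mxM hP (is_derive_mx_tr dL))) hW.
rewrite scale0r addr0 => dG.
suff : dA *m P 0 + A *m dP + (dP *m A^T + P 0 *m dA^T) + dW = 0.
  by move=> <-; rewrite (addrC (dA *m P 0) (A *m dP)) [in RHS]addrACA !addrA.
apply/matrixP => i j.
have /(@derive_val _ _ _ _ _ _ _) <- := dG i j.
rewrite (@near_eq_derive _ _ _ _ (cst 0)); last first.
  by apply: filterS h0 => e /= ->; rewrite mxE.
by rewrite derive_cst mxE.
Qed.

End Perturbation.

Lemma is_derive_min_eq0 (R : realType) (f : R -> R) (d : R) :
  is_derive (0 : R) 1 f d -> (\forall e \near (0 : R), f 0 <= f e) -> d = 0.
Proof.
move=> [df fd] hmin; apply/eqP/negPn/negP => d0.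
have dd : 0 < d * d by rewrite -expr2 exprn_even_gt0.
have : \forall h \near (0 : R)^', 0 < h^-1 *: (f (h *: 1 + 0) - f 0) * d.
  have hc : h^-1 *: (f (h *: 1 + 0) - f 0) @[h --> (0 : R)^'] --> d.
    by rewrite -fd; exact: df.
  have hcd : h^-1 *: (f (h *: 1 + 0) - f 0) * d @[h --> (0 : R)^'] --> d * d.
    by apply: cvgM hc _; exact: cvg_cst.
  exact: (cvgr_gt _ hcd).
move=> [r /= r0 hr]; move: hmin => [s /= s0 hs].
pose t := Num.min r s / 2; have t0 : 0 < t.
  by rewrite divr_gt0 // lt_min r0 s0.
have [tr ts] : t < r /\ t < s.
  have : t < Num.min r s.
    by rewrite /t ltr_pdivrMr // ltr_pMr ?lt_min ?r0 // ltr1n.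
  by rewrite lt_min => /andP.
(* a step against the sign of the derivative *)
pose h := - (t * Num.sg d).
have nh : `|h| = t by rewrite normrN normrM normr_sg d0 mulr1 gtr0_norm.
have h0 : h != 0 by rewrite -normr_eq0 nh gt_eqF.
have /hr/(_ h0) : ball_ Num.norm 0 r h by rewrite /= sub0r normrN nh.
have /hs : ball_ Num.norm 0 s h by rewrite /= sub0r normrN nh.
rewrite /GRing.scale /= mulr1 addr0 -subr_ge0 => q0; rewrite mulrAC => hq.
have : h^-1 * d <= 0.
  rewrite -(pmulr_rle0 _ (exprn_gt0 2 t0)) -nh real_normK ?num_real //.
  rewrite expr2 mulrA mulfK // /h mulNr -mulrA.
  by rewrite -normrEsg oppr_le0 mulr_ge0 // ltW.
by move=> hd; have := mulr_le0_ge0 hd q0; rewrite leNgt hq.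
Qed.

(** The adjoint equation for [Q] removes the derivative of [P] from the first
    variation of [tr (C P C^T) + \sum_k tr (M_k P M_k^T P)]. *)
Section Gradient.
Variables (R : realType) (n m p : nat).
Variables (A dA : 'M[R]_n) (B dB : 'M[R]_(n, m)) (C dC : 'M[R]_(p, n)).
Variables (M dM : 'I_p -> 'M[R]_n) (Q : 'M[R]_n) (P : R -> 'M[R]_n).
Variable dP : 'M[R]_n.

Let W (e : R) := (B + e *: dB) *m (B + e *: dB)^T.

Lemma is_derive_gram :
  is_derive_mx W 0 (dB *m B^T + B *m dB^T).
Proof.
have dL := is_derive_mx_line B dB 0.
by have := is_derive_mxM dL (is_derive_mx_tr dL); rewrite scale0r addr0.
Qed.

Hypothesis hdP : is_derive_mx P 0 dP.
Hypothesis hP : \forall e \near (0 : R),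
  (A + e *: dA) *m P e + P e *m (A + e *: dA)^T + W e = 0.
Hypothesis Psym : (P 0)^T = P 0.
Hypothesis Qsym : Q^T = Q.
Hypothesis Msym : forall k, (M k)^T = M k.
Hypothesis hQ : A^T *m Q + Q *m A + (C^T *m C + 2 *: \sum_k M k *m P 0 *m M k)
  = 0.

Let J (e : R) := \tr ((C + e *: dC) *m P e *m (C + e *: dC)^T) +
  \sum_k \tr ((M k + e *: dM k) *m P e *m (M k + e *: dM k)^T *m P e).

Lemma first_variation : is_derive (0 : R) 1 J
  (2 * (\tr (Q *m dA *m P 0) + \tr (Q *m dB *m B^T)
     + \tr (dC *m P 0 *m C^T) + \sum_k \tr (dM k *m P 0 *m M k *m P 0))).
Proof.
have lC := is_derive_mx_line C dC 0.
have lM k := is_derive_mx_line (M k) (dM k) 0.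
have d1 := is_derive_mxtrace (is_derive_mxM (is_derive_mxM lC hdP)
  (is_derive_mx_tr lC)).
have d2 k := is_derive_mxtrace (is_derive_mxM (is_derive_mxM
  (is_derive_mxM (lM k) hdP) (is_derive_mx_tr (lM k))) hdP).
have := is_deriveD d1 (is_derive_sum d2).
rewrite (_ : _ + _ = J); last first.
  by apply/funext => e; rewrite /J addrfctE fct_sumE.
move=> dJ; apply: (is_derive_eq dJ).
rewrite scale0r addr0.
have adj := lyapunov_family_derive is_derive_gram hdP hP.
(* tr (H dP) = tr (Q W'), by pairing both Lyapunov equations *)
have key : \tr ((C^T *m C + 2 *: \sum_k M k *m P 0 *m M k) *m dP) =
    2 * (\tr (Q *m dA *m P 0) + \tr (Q *m dB *m B^T)).
  have -> : C^T *m C + 2 *: \sum_k M k *m P 0 *m M k = - (A^T *m Q + Q *m A).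
    by apply/eqP; rewrite -addr_eq0 addrC hQ.
  have e1 : \tr ((A^T *m Q + Q *m A) *m dP) = \tr (Q *m (A *m dP + dP *m A^T)).
    rewrite mulmxDl mulmxDr !mxtraceD -!mulmxA addrC; congr (_ + _).
    by rewrite [LHS]mxtrace_mulC mulmxA.
  have e2 : A *m dP + dP *m A^T =
      - (dA *m P 0 + P 0 *m dA^T + (dB *m B^T + B *m dB^T)).
    by apply/eqP; rewrite -addr_eq0 adj.
  rewrite mulNmx linearN /= e1 e2 mulmxN linearN opprK /= !mulmxDr !mxtraceD.
  rewrite -[\tr (Q *m (P 0 *m dA^T))]mxtrace_tr !trmx_mul trmxK Psym Qsym.
  rewrite -[\tr (Q *m (B *m dB^T))]mxtrace_tr !trmx_mul trmxK Qsym.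
  rewrite [\tr (dA *m P 0 *m Q)]mxtrace_mulC [\tr (dB *m B^T *m Q)]mxtrace_mulC.
  by rewrite !mulmxA; ring.
rewrite mulmxDl mxtraceD -scalemxAl mxtraceZ mulmx_suml in key.
rewrite raddf_sum /= in key.
have c1 : \tr ((dC *m P 0 + C *m dP) *m C^T + C *m P 0 *m dC^T) =
    2 * \tr (dC *m P 0 *m C^T) + \tr (C^T *m C *m dP).
  rewrite mulmxDl !mxtraceD -[\tr (C *m P 0 *m dC^T)]mxtrace_tr.
  rewrite !trmx_mul trmxK Psym mulmxA.
  by rewrite [\tr (C *m dP *m C^T)]mxtrace_mulC mulmxA; ring.
have c2 k : \tr (((dM k *m P 0 + M k *m dP) *m (M k)^T +
      M k *m P 0 *m (dM k)^T) *m P 0 + M k *m P 0 *m (M k)^T *m dP) =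
    2 * \tr (dM k *m P 0 *m M k *m P 0) + 2 * \tr (M k *m P 0 *m M k *m dP).
  rewrite !mulmxDl !mxtraceD Msym.
  have -> : \tr (M k *m P 0 *m (dM k)^T *m P 0) =
      \tr (dM k *m P 0 *m M k *m P 0).
    rewrite -mxtrace_tr !trmx_mul trmxK Psym Msym.
    by rewrite mxtrace_mulC !mulmxA.
  have -> : \tr (M k *m dP *m M k *m P 0) = \tr (M k *m P 0 *m M k *m dP).
    by rewrite -mulmxA mxtrace_mulC !mulmxA.
  by ring.
rewrite c1; under eq_bigr => k _ do rewrite scale0r addr0 c2.
rewrite big_split /= -!mulr_sumr.
move: key; set s1 := \tr (C^T *m C *m dP); set s2 := \sum_k \tr (_ *m dP).
move=> key.
rewrite mulrDr mulrDr -key; ring.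
Qed.

End Gradient.

(** * Stationarity at a local minimizer *)

Section Stationarity.
Variables (R : realType) (n r m p : nat).
Variables (A : 'M[R]_n) (B : 'M[R]_(n, m)) (C : 'M[R]_(p, n)).
Variable M : 'I_p -> 'M[R]_n.
Variables (Ar : 'M[R]_r) (Br : 'M[R]_(r, m)) (Cr : 'M[R]_(p, r)).
Variable Mr : 'I_p -> 'M[R]_r.
Variables (dA : 'M[R]_r) (dB : 'M[R]_(r, m)) (dC : 'M[R]_(p, r)).
Variable dM : 'I_p -> 'M[R]_r.

Let S : lqo R n m p := (A, B, C, M).
Let Sr : lqo R r m p := (Ar, Br, Cr, Mr).
Let line (e : R) : lqo R r m p :=
  (Ar + e *: dA, Br + e *: dB, Cr + e *: dC, fun k => Mr k + e *: dM k).

Let cvg_mx_line a b (X D : 'M[R]_(a, b)) :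
  X + e *: D @[e --> (0 : R)] --> X.
Proof.
apply: cvg_mxP => i j.
have -> : X i j = (X + 0 *: D) i j by rewrite scale0r addr0.
exact: is_derive_continuous (is_derive_mx_line X D 0 i j).
Qed.

Lemma cvg_lqo_line : line e @[e --> (0 : R)] --> Sr.
Proof.
have hM : (fun k => Mr k + e *: dM k) @[e --> (0 : R)]
    --> (Mr : {ptws 'I_p -> 'M[R]_r}).
  apply/cvg_sup => k; rewrite cvg_image; last first.
    by rewrite eqEsubset; split=> v // _; exists (cst v).
  move=> U /(@cvg_mx_line _ _ (Mr k) (dM k)) hU.
  exists ((fun g => g k) @^-1` U) => //.
  by rewrite eqEsubset; split => [v [? + <-//]|v Uv]; exists (fun _ => v).
have H := cvg_pair (cvg_pair (cvg_pair (@cvg_mx_line _ _ Ar dA)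
  (@cvg_mx_line _ _ Br dB)) (@cvg_mx_line _ _ Cr dC)) hM.
have F1 := @nbhs_filter _ (Ar : 'M[R]_r).
have F2 := @nbhs_filter _ (Br : 'M[R]_(r, m)).
have F3 := @nbhs_filter _ (Cr : 'M[R]_(p, r)).
have F4 := @nbhs_filter _ (Mr : {ptws 'I_p -> 'M[R]_r}).
have F0 := @nbhs_filter _ (0 : R).
have F5 : Filter (nbhs (nbhs Ar, nbhs Br)) by exact: filter_prod_filter.
have F6 : Filter (nbhs (nbhs (nbhs Ar, nbhs Br), nbhs Cr)).
  exact: filter_prod_filter.
exact: (H F0 F6 F4 F0 F5 F3 F0 F1 F2).
Qed.

(** Stable matrices being an open set, the constraint does not interfere with
    small steps in any direction. *)
Lemma local_minimizer_line :
  hurwitz Ar ->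
  local_minimizer [set S' : lqo R r m p | asymptotically_stable S']
    (h2_error_sq S) Sr ->
  \forall e \near (0 : R), hurwitz (Ar + e *: dA) /\
    (h2_error_sq S Sr <= h2_error_sq S (line e))%E.
Proof.
move=> hAr [_ hmin].
have {}hmin : \forall e \near (0 : R), asymptotically_stable (line e) ->
    (h2_error_sq S Sr <= h2_error_sq S (line e))%E.
  exact: (cvg_lqo_line hmin).
have [d d0 hd] := hurwitz_perturb dA hAr.
have hs : \forall e \near (0 : R), hurwitz (Ar + e *: dA).
  by apply: filterS (nbhs0_lt d0) => e; exact: hd.
apply: filterS2 hs hmin => e he hle; split; first exact: he.
exact: (hle he).
Qed.

End Stationarity.

Section FirstOrder.
Variables (R : realType) (n r m p : nat).

Lemma mxtrace_gram_eq0 a b (K : 'M[R]_(a, b)) : \tr (K^T *m K) = 0 -> K = 0.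
Proof.
rewrite mxtrace_mulC => /psumr_eq0P h; apply/matrixP => i j; rewrite mxE.
have sq k l : 0 <= K k l * (K^T) l k by rewrite mxE -expr2 sqr_ge0.
have /h/(_ i isT) : forall i, true -> 0 <= (K *m K^T) i i.
  by move=> k _; rewrite mxE sumr_ge0.
rewrite mxE => /psumr_eq0P/(_ j isT) h2.
have /eqP := h2 (fun l _ => sq i l).
by rewrite mxE -expr2 sqrf_eq0 => /eqP.
Qed.

Lemma sum_block_mx (I : finType) a b c d (F : I -> 'M[R]_(a, c))
    (G : I -> 'M[R]_(a, d)) (H : I -> 'M[R]_(b, c)) (K : I -> 'M[R]_(b, d)) :
  \sum_i block_mx (F i) (G i) (H i) (K i) =
    block_mx (\sum_i F i) (\sum_i G i) (\sum_i H i) (\sum_i K i).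
Proof.
elim: (index_enum I) => [|i s IH]; first by rewrite !big_nil block_mx0.
by rewrite !big_cons IH add_block_mx.
Qed.

Variables (A : 'M[R]_n) (B : 'M[R]_(n, m)) (C : 'M[R]_(p, n)).
Variable M : 'I_p -> 'M[R]_n.
Variables (Ar : 'M[R]_r) (Br : 'M[R]_(r, m)) (Cr : 'M[R]_(p, r)).
Variable Mr : 'I_p -> 'M[R]_r.

Let S : lqo R n m p := (A, B, C, M).
Let Sr : lqo R r m p := (Ar, Br, Cr, Mr).
Let Ae := block_mx A 0 0 Ar.
Let Be := col_mx B Br.
Let Ce := row_mx C (- Cr).
Let Me k := block_mx (M k) 0 0 (- Mr k).

Hypothesis hA : hurwitz A.
Hypothesis hAr : hurwitz Ar.
Hypothesis Msym : forall k, (M k)^T = M k.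
Hypothesis Mrsym : forall k, (Mr k)^T = Mr k.
Hypothesis hmin : local_minimizer
  [set S' : lqo R r m p | asymptotically_stable S'] (h2_error_sq S) Sr.

Let flowE : stable_flow Ae
  (fun t => block_mx (expmx (t *: A)) 0 0 (expmx (t *: Ar))).
Proof. by apply: stable_flow_block; exact: stable_flow_expmx. Qed.

Let Mesym k : (Me k)^T = Me k.
Proof. by rewrite /Me tr_block_mx !trmx0 linearN /= Msym Mrsym. Qed.

(** Along a line in the space of reduced systems only the blocks of the error
    system that come from the reduced one move; the left-hand side is half of
    the derivative of the error there. *)
Lemma stationarity (P Q : 'M[R]_(n + r)) (dA : 'M[R]_r) (dB : 'M[R]_(r, m))
    (dC : 'M[R]_(p, r)) (dM : 'I_p -> 'M[R]_r) :
  Ae *m P + P *m Ae^T + Be *m Be^T = 0 ->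
  Ae^T *m Q + Q *m Ae + (Ce^T *m Ce + 2 *: \sum_k Me k *m P *m Me k) = 0 ->
  \tr (Q *m block_mx 0 0 0 dA *m P) + \tr (Q *m col_mx 0 dB *m Be^T)
    + \tr (row_mx 0 (- dC) *m P *m Ce^T)
    + \sum_k \tr (block_mx 0 0 0 (- dM k) *m P *m Me k *m P) = 0.
Proof.
move=> hP hQ.
pose D : 'M[R]_(n + r) := block_mx 0 0 0 dA.
have [Pf [dP [hdP hPf]]] := lyapunov_family D (lyapunov_mx_unit flowE)
  (is_derive_gram Be (col_mx 0 dB)).
have Pf0 : Pf 0 = P.
  apply: (lyapunov_unique flowE _ hP).
  by have := nbhs_singleton hPf; rewrite /= !scale0r !addr0.
have Psym : P^T = P.
  by apply: (lyapunov_sym flowE _ hP); rewrite trmx_mul trmxK.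
have Qsym : Q^T = Q.
  apply: (lyapunov_sym (stable_flow_tr flowE)); last first.
    by rewrite trmxK; exact: hQ.
  rewrite linearD linearZ /= trmx_mul trmxK linear_sum /=; congr (_ + _ *: _).
  apply: eq_bigr => k _; rewrite !trmx_mul Psym Mesym.
  by rewrite mulmxA.
rewrite -Pf0 in Psym hQ *.
pose J (e : R) :=
  \tr ((Ce + e *: row_mx 0 (- dC)) *m Pf e *m (Ce + e *: row_mx 0 (- dC))^T) +
  \sum_k \tr ((Me k + e *: block_mx 0 0 0 (- dM k)) *m Pf e *m
    (Me k + e *: block_mx 0 0 0 (- dM k))^T *m Pf e).
have dJ := first_variation (row_mx 0 (- dC))
  (fun k => block_mx 0 0 0 (- dM k)) hdP hPf Psym Qsym Mesym hQ.
suff hJmin : \forall e \near (0 : R), J 0 <= J e.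
  have /eqP := is_derive_min_eq0 dJ hJmin.
  by rewrite mulf_eq0 pnatr_eq0 => /eqP.
pose line (e : R) : lqo R r m p :=
  (Ar + e *: dA, Br + e *: dB, Cr + e *: dC, fun k => Mr k + e *: dM k).
have hline := local_minimizer_line dA dB dC dM hAr hmin.
have hJ : \forall e \near (0 : R),
    (h2_error_sq S Sr <= h2_error_sq S (line e))%E /\
    h2_error_sq S (line e) = (J e)%:E.
  apply: filterS2 hline hPf => e [he hle] hPe; split; first exact: hle.
  have eA : Ae + e *: D = block_mx A 0 0 (Ar + e *: dA).
    by rewrite scale_block_mx add_block_mx !scaler0 !addr0.
  have eB : Be + e *: col_mx 0 dB = col_mx B (Br + e *: dB).
    by rewrite scale_col_mx add_col_mx scaler0 addr0.
  have eC : Ce + e *: row_mx 0 (- dC) = row_mx C (- (Cr + e *: dC)).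
    by rewrite scale_row_mx add_row_mx scaler0 addr0 scalerN opprD.
  have eM k : Me k + e *: block_mx 0 0 0 (- dM k) =
      block_mx (M k) 0 0 (- (Mr k + e *: dM k)).
    by rewrite scale_block_mx add_block_mx !scaler0 !addr0 scalerN opprD.
  rewrite eA eB in hPe; rewrite (h2_error_sqE _ _ _ _ hA he hPe) /J eC.
  by under [in RHS]eq_bigr => k _ do rewrite eM.
have line0 : line 0 = Sr.
  rewrite /line !scale0r !addr0; congr (_, _).
  by apply/funext => k; rewrite scale0r addr0.
have [_ hJ0] := nbhs_singleton hJ; rewrite line0 in hJ0.
by apply: filterS hJ => e [hle hJe]; rewrite hJ0 hJe lee_fin in hle.
Qed.

Variables (X Z Z1 : 'M[R]_(n, r)) (Pr Qr Q1r : 'M[R]_r).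
Hypothesis hPr : Ar *m Pr + Pr *m Ar^T + Br *m Br^T = 0.
Hypothesis hQr : Ar^T *m Qr + Qr *m Ar + \sum_(k < p) Mr k *m Pr *m Mr k
  + Cr^T *m Cr = 0.
Hypothesis hX : A *m X + X *m Ar^T + B *m Br^T = 0.
Hypothesis hZ : A^T *m Z + Z *m Ar - \sum_(k < p) M k *m X *m Mr k
  - C^T *m Cr = 0.
Hypothesis hQ1r : Ar^T *m Q1r + Q1r *m Ar + Cr^T *m Cr = 0.
Hypothesis hZ1 : A^T *m Z1 + Z1 *m Ar - C^T *m Cr = 0.

Let flowA : stable_flow A (fun t => expmx (t *: A)).
Proof. exact: stable_flow_expmx. Qed.

Let flowAr : stable_flow Ar (fun t => expmx (t *: Ar)).
Proof. exact: stable_flow_expmx. Qed.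

Lemma reduced_gramian_sym : Pr^T = Pr.
Proof. by apply: (lyapunov_sym flowAr _ hPr); rewrite trmx_mul trmxK. Qed.

(* the off-diagonal and lower diagonal blocks of the adjoint Gramian *)
Let Y := 2 *: Z - Z1.
Let V := 2 *: Qr - Q1r.

Let hV : Ar^T *m V + V *m Ar +
  (Cr^T *m Cr + 2 *: \sum_k Mr k *m Pr *m Mr k) = 0.
Proof.
have := congr2 (fun a b => 2 *: a - b) hQr hQ1r; rewrite /= scaler0 subr0 => h.
rewrite -[RHS]h {h}.
rewrite /V mulmxBr mulmxBl -!scalemxAr -!scalemxAl.
move: (Ar^T *m Qr) (Qr *m Ar) (\sum_k _) (Cr^T *m Cr) (Ar^T *m Q1r)
  (Q1r *m Ar) => a b c d e f.
by apply/matrixP => i j; rewrite !mxE; ring.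
Qed.

Let hY : A^T *m Y + Y *m Ar -
  (C^T *m Cr + 2 *: \sum_k M k *m X *m Mr k) = 0.
Proof.
have := congr2 (fun a b => 2 *: a - b) hZ hZ1; rewrite /= scaler0 subr0 => h.
rewrite -[RHS]h {h}.
rewrite /Y mulmxBr mulmxBl -!scalemxAr -!scalemxAl.
move: (A^T *m Z) (Z *m Ar) (\sum_k _) (C^T *m Cr) (A^T *m Z1)
  (Z1 *m Ar) => a b c d e f.
by apply/matrixP => i j; rewrite !mxE; ring.
Qed.

Lemma reduced_adjoint_sym : V^T = V.
Proof.
apply: (lyapunov_sym (stable_flow_tr flowAr)); last by rewrite trmxK; exact: hV.
rewrite linearD linearZ /= trmx_mul trmxK linear_sum /=; congr (_ + _ *: _).
apply: eq_bigr => k _; rewrite !trmx_mul reduced_gramian_sym Mrsym.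
by rewrite mulmxA.
Qed.

(** In blocks, the first variation is the sum of the pairings
    [tr (D K)] of each direction [D] with a matrix [K] that is, up to
    transposition, the left-hand side of one condition. *)
Lemma first_order_conditions :
  [/\ V *m Pr + Y^T *m X = 0, V *m Br + Y^T *m B = 0, Cr *m Pr - C *m X = 0
    & forall k, Pr *m Mr k *m Pr - X^T *m M k *m X = 0].
Proof.
have [P1 hP1] := lyapunov_exists (B *m B^T) flowA.
have [Q1 hQ1] := lyapunov_exists (C^T *m C + 2 *: \sum_k M k *m P1 *m M k)
  (stable_flow_tr flowA).
rewrite trmxK in hQ1.
pose P := block_mx P1 X X^T Pr; pose Q := block_mx Q1 Y Y^T V.
have hXT : Ar *m X^T + X^T *m A^T + Br *m B^T = 0.
  apply: trmx_inj; rewrite !linearD /= !trmx_mul !trmxK trmx0.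
  by rewrite (addrC (X *m _)) hX.
have hYT : Ar^T *m Y^T + Y^T *m A -
    (Cr^T *m C + 2 *: \sum_k Mr k *m X^T *m M k) = 0.
  have sT : (\sum_k M k *m X *m Mr k)^T = \sum_k Mr k *m X^T *m M k.
    rewrite linear_sum; apply: eq_bigr => k _ /=.
    by rewrite !trmx_mul Msym Mrsym mulmxA.
  have := congr1 trmx hY; rewrite trmx0 => hYt; rewrite -[RHS]hYt -sT.
  rewrite [in RHS]linearB /= [in RHS]linearD /= [X in _ = _ - X]linearD linearZ.
  by rewrite /= !trmx_mul !trmxK (addrC (_ *m A)).
have hP : Ae *m P + P *m Ae^T + Be *m Be^T = 0.
  rewrite /Ae /P /Be tr_block_mx !trmx0 !mulmx_block tr_col_mx mul_col_row.
  rewrite !mul0mx !mulmx0 !addr0 !add0r !add_block_mx hP1 hX hPr hXT.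
  exact: block_mx0.
have hQ : Ae^T *m Q + Q *m Ae +
    (Ce^T *m Ce + 2 *: \sum_k Me k *m P *m Me k) = 0.
  have MPM k : Me k *m P *m Me k = block_mx (M k *m P1 *m M k)
      (- (M k *m X *m Mr k)) (- (Mr k *m X^T *m M k)) (Mr k *m Pr *m Mr k).
    rewrite /Me /P !mulmx_block !mul0mx !mulmx0 !addr0 !add0r.
    by rewrite !mulNmx !mulmxN ?mulNmx opprK.
  under eq_bigr do rewrite MPM.
  rewrite sum_block_mx /Ae /Q /Ce tr_block_mx !trmx0 tr_row_mx mul_col_row.
  rewrite !mulmx_block !mul0mx !mulmx0 !addr0 !add0r scale_block_mx.
  rewrite !add_block_mx hQ1 [(- Cr)^T]linearN /= !mulNmx !mulmxN opprK hV.
  rewrite !sumrN !scalerN.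
  by rewrite -!opprD hY hYT block_mx0.
pose K1 := X^T *m Y + Pr *m V; pose K2 := B^T *m Y + Br^T *m V.
pose K3 := Pr *m Cr^T - X^T *m C^T.
pose K4 k := Pr *m Mr k *m Pr - X^T *m M k *m X.
(* in the directions K_i^T the variation is the sum of the squared norms *)
have := stationarity K1^T K2^T K3^T (fun k => (K4 k)^T) hP hQ.
have -> : \tr (Q *m block_mx 0 0 0 K1^T *m P) = \tr (K1^T *m K1).
  move: K1^T => D; rewrite /Q /P !mulmx_block.
  rewrite !(mulmx0, mul0mx, addr0, add0r) mxtrace_block.
  rewrite /K1 mulmxDr mxtraceD -!mulmxA.
  by rewrite [\tr (Y *m _)]mxtrace_mulC [\tr (V *m _)]mxtrace_mulC !mulmxA.
have -> : \tr (Q *m col_mx 0 K2^T *m Be^T) = \tr (K2^T *m K2).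
  move: K2^T => D; rewrite /Q /Be mul_block_col.
  rewrite !(mulmx0, mul0mx, addr0, add0r) tr_col_mx mul_col_row.
  rewrite mxtrace_block /K2 mulmxDr mxtraceD -!mulmxA.
  by rewrite [\tr (Y *m _)]mxtrace_mulC [\tr (V *m _)]mxtrace_mulC !mulmxA.
have -> : \tr (row_mx 0 (- K3^T) *m P *m Ce^T) = \tr (K3^T *m K3).
  move: K3^T => D; rewrite /P /Ce mul_row_block.
  rewrite !(mulmx0, mul0mx, addr0, add0r) tr_row_mx mul_row_col.
  by rewrite linearN /= !mulNmx mulmxN opprK /K3 mulmxBr !mulmxA addrC.
have K4E k : \tr (block_mx 0 0 0 (- (K4 k)^T) *m P *m Me k *m P) =
    \tr ((K4 k)^T *m K4 k).
  move: (K4 k)^T => D; rewrite /P /Me !mulmx_block.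
  rewrite !(mulmx0, mul0mx, addr0, add0r) mxtrace_block.
  rewrite ?mxtrace0 ?add0r.
  by rewrite !mulNmx mulmxN mulNmx opprK /K4 mulmxBr !mulmxA addrC.
under eq_bigr do rewrite K4E.
have tr0 a b (K : 'M[R]_(a, b)) : 0 <= \tr (K^T *m K).
  by rewrite mxtrace_mulC mxtrace_gram_ge0.
have s0 : 0 <= \sum_k \tr ((K4 k)^T *m K4 k) by apply: sumr_ge0.
move=> /eqP; rewrite !paddr_eq0 ?addr_ge0 //.
move=> /andP[/andP[/andP[/eqP h1 /eqP h2] /eqP h3] /eqP h4].
have trV := reduced_adjoint_sym; have trP := reduced_gramian_sym.
split.
- have := congr1 trmx (mxtrace_gram_eq0 h1).
  by rewrite /K1 linearD /= !trmx_mul trmxK trV trP trmx0 addrC.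
- have := congr1 trmx (mxtrace_gram_eq0 h2).
  by rewrite /K2 linearD /= !trmx_mul !trmxK trV trmx0 addrC.
- have := congr1 trmx (mxtrace_gram_eq0 h3).
  by rewrite /K3 linearB /= !trmx_mul !trmxK trP trmx0.
move=> k; apply: mxtrace_gram_eq0.
by move/psumr_eq0P: h4 => /(_ (fun k _ => tr0 _ _ (K4 k)) k isT).
Qed.

(** The conditions give [W_r^T X = P_r] and [W_r^T B = B_r]; the identity for
    [A_r] then comes from multiplying the Sylvester equation for [X] by [W_r^T]
    and comparing with the equation for [P_r]. *)
Lemma petrov_galerkin :
  Pr \in unitmx -> V \in unitmx ->
  let Vr := X *m invmx Pr in
  let Wr := - (Y *m invmx V) in
  [/\ Ar = invmx (Wr^T *m Vr) *m Wr^T *m A *m Vr,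
      Br = invmx (Wr^T *m Vr) *m Wr^T *m B,
      Cr = C *m Vr,
      forall k : 'I_p, Mr k = Vr^T *m M k *m Vr
    & Wr^T *m Vr = 1%:M].
Proof.
move=> uP uV Vr Wr; have [c1 c2 c3 c4] := first_order_conditions.
have trP := reduced_gramian_sym.
have WT : Wr^T = - (invmx V *m Y^T).
  by rewrite linearN /= trmx_mul trmx_inv reduced_adjoint_sym.
have WX : Wr^T *m X = Pr.
  rewrite WT mulNmx -mulmxA (_ : Y^T *m X = - (V *m Pr)).
    by rewrite mulmxN opprK mulKmx.
  by apply/eqP; rewrite -addr_eq0 addrC c1.
have WB : Wr^T *m B = Br.
  rewrite WT mulNmx -mulmxA (_ : Y^T *m B = - (V *m Br)).
    by rewrite mulmxN opprK mulKmx.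
  by apply/eqP; rewrite -addr_eq0 addrC c2.
have WV : Wr^T *m Vr = 1%:M by rewrite mulmxA WX mulmxV.
rewrite WV invmx1 !mul1mx WB; split=> //.
- rewrite -!mulmxA [A *m _]mulmxA.
  have -> : A *m X = - (X *m Ar^T + B *m Br^T).
    by apply/eqP; rewrite -addr_eq0 addrA hX.
  rewrite mulNmx mulmxN mulmxA mulmxDr !mulmxA WX WB.
  rewrite (_ : Pr *m Ar^T + Br *m Br^T = - (Ar *m Pr)).
    by rewrite mulNmx opprK mulmxK.
  by apply/eqP; rewrite -addr_eq0 addrC addrA hPr.
- rewrite mulmxA (_ : C *m X = Cr *m Pr) ?mulmxK //.
  by apply/esym/eqP; rewrite -subr_eq0 c3.
move=> k; rewrite trmx_mul trmx_inv trP -!mulmxA.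
have : X^T *m (M k *m X) = Pr *m (Mr k *m Pr).
  by apply/esym/eqP; rewrite !mulmxA -subr_eq0 c4.
move=> h; rewrite [M k *m _]mulmxA [X^T *m _]mulmxA h.
by rewrite !mulmxA mulVmx // mul1mx mulmxK.
Qed.

End FirstOrder.

Theorem theorem3p2 (R : realType) (n r m p : nat)
    (A : 'M[R]_n) (B : 'M[R]_(n, m)) (C : 'M[R]_(p, n)) (M : 'I_p -> 'M[R]_n)
    (Ar : 'M[R]_r) (Br : 'M[R]_(r, m)) (Cr : 'M[R]_(p, r))
    (Mr : 'I_p -> 'M[R]_r)
    (X Z Z1 : 'M[R]_(n, r)) (Pr Qr Q1r : 'M[R]_r) :
  let S : lqo R n m p := (A, B, C, M) in
  let Sr : lqo R r m p := (Ar, Br, Cr, Mr) in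
  lqo_symmetric S -> lqo_symmetric Sr ->
  asymptotically_stable S -> asymptotically_stable Sr ->
  local_minimizer [set S' : lqo R r m p | asymptotically_stable S']
    (h2_error_sq S) Sr ->
  Ar *m Pr + Pr *m Ar^T + Br *m Br^T = 0 ->
  Ar^T *m Qr + Qr *m Ar + \sum_(k < p) Mr k *m Pr *m Mr k + Cr^T *m Cr = 0 ->
  A *m X + X *m Ar^T + B *m Br^T = 0 ->
  A^T *m Z + Z *m Ar - \sum_(k < p) M k *m X *m Mr k - C^T *m Cr = 0 ->
  Ar^T *m Q1r + Q1r *m Ar + Cr^T *m Cr = 0 ->
  A^T *m Z1 + Z1 *m Ar - C^T *m Cr = 0 ->
  [/\ 0 = (2 *: Qr - Q1r) *m Pr + (2 *: Z^T - Z1^T) *m X,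
      0 = (2 *: Qr - Q1r) *m Br + (2 *: Z^T - Z1^T) *m B,
      0 = Cr *m Pr - C *m X
    & forall k : 'I_p, 0 = Pr *m Mr k *m Pr - X^T *m M k *m X] /\
  (Pr \in unitmx -> 2 *: Qr - Q1r \in unitmx ->
   let Vr := X *m invmx Pr in
   let Wr := - ((2 *: Z - Z1) *m invmx (2 *: Qr - Q1r)) in
   [/\ Ar = invmx (Wr^T *m Vr) *m Wr^T *m A *m Vr,
       Br = invmx (Wr^T *m Vr) *m Wr^T *m B,
       Cr = C *m Vr,
       forall k : 'I_p, Mr k = Vr^T *m M k *m Vr
     & Wr^T *m Vr = 1%:M]).
Proof.
move=> S Sr symS symSr hA hAr hmin hPr hQr hX hZ hQ1r hZ1.
have fo := first_order_conditions hA hAr symS symSr hmin hPr hQr hX hZ hQ1r hZ1.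
have pg := petrov_galerkin hA hAr symS symSr hmin hPr hQr hX hZ hQ1r hZ1.
split; last exact: pg.
have [c1 c2 c3 c4] := fo; rewrite linearB linearZ /= in c1 c2.
by split=> // k; rewrite c4.
Qed.
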